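(* Let $n\ge 2$ be an integer, let $s\in(0,1)\setminus\{\tfrac12\}$, and let $f=(f_j)_{j=1}^n\in\mathcal{S}(\mathbb{R}^n;S^1(\mathbb{R}^n))$. Let $U\subset\mathbb{R}^n$ be any non-empty open set. If $f|_U=0$ and there exists a measurable set $E\subset U$ of positive measure such that $\mathcal{A}^0_{1,s}f=\mathcal{A}^1_{1,s}f=0$ in $E$, then $f\equiv 0$ in $\mathbb{R}^n$.
   Context: $\mathcal{S}(\mathbb{R}^n;S^1(\mathbb{R}^n))$ is the space of vector fields on $\mathbb{R}^n$ with complex-valued Schwartz components. Repeated indices are summed from $1$ to $n$. The fractional divergent beam ray transform of $f$ is $(\chi_{s,1}f)(x,\xi)=\int_0^\infty t^{2s-1}f_j(x+t\xi)\xi^j\,dt$ for $x\in\mathbb{R}^n$, $\xi\in\mathbb{S}^{n-1}$. Its averages are $$\mathcal{A}^0_{1,s}f(x)=c^{1,0}_{n,s}\int_{\mathbb{S}^{n-1}}(\chi_{s,1}f)(x,\xi)\,dS_\xi,\qquad \mathcal{A}^{1,i}_{1,s}f(x)=c^{1,1}_{n,s}\int_{\mathbb{S}^{n-1}}\xi^i(\chi_{s,1}f)(x,\xi)\,dS_\xi,$$ and $\mathcal{A}^1_{1,s}f=(\mathcal{A}^{1,i}_{1,s}f)_{i=1}^n$, with the nonzero constants $$c^{1,0}_{n,s}=\frac{-\Gamma\left(\frac{n+1-2s}{2}\right)}{2^{2s}\pi^{n/2}\Gamma\left(s+\frac12\right)},\qquad c^{1,1}_{n,s}=\frac{-\Gamma\left(\frac{n+2-2s}{2}\right)}{2^{2s-1}\pi^{n/2}\Gamma(s)}.$$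 *)

(* Defs.v *)
From HB Require Import structures.
From mathcomp Require Import all_boot all_order all_algebra.
From mathcomp Require Import complex.
From mathcomp Require Import all_classical all_reals all_analysis.
From mathcomp Require Import measurable_realfun.

Set Implicit Arguments.
Unset Strict Implicit.
Unset Printing Implicit Defensive.

Import Order.TTheory GRing.Theory Num.Theory.
Import numFieldNormedType.Exports.

Local Open Scope classical_set_scope.
Local Open Scope ring_scope.
Local Open Scope complex_scope.

(* R^n is the space of row vectors 'rV[R]_n. Its library topology is that of
   the sup norm, i.e. the usual topology; the Euclidean norm is enorm below. *)

Section borel_rV.
Context {R : realType} (n : nat).

Let coords (i : 'I_n) : 'rV[R]_n -> measurableTypeR R := fun x => x ord0 i.

Let rV_set0 : g_sigma_preimage coords set0.
Proof. exact: sigma_algebra0. Qed.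

Let rV_setC A : g_sigma_preimage coords A -> g_sigma_preimage coords (~` A).
Proof. exact: sigma_algebraC. Qed.

Let rV_bigcup (F : (set 'rV[R]_n)^nat) :
  (forall i, g_sigma_preimage coords (F i)) ->
  g_sigma_preimage coords (\bigcup_i (F i)).
Proof. exact: sigma_algebra_bigcup. Qed.

(* The product sigma-algebra on R^n, generated by the coordinates (as the
   library does for tuples); it is the Borel sigma-algebra. *)
HB.instance Definition _ :=
  @isMeasurable.Build (measure_tuple_display default_measure_display)
    'rV[R]_n (g_sigma_preimage coords) rV_set0 rV_setC rV_bigcup.

Lemma measurable_coord (i : 'I_n) :
  measurable_fun [set: 'rV[R]_n]
    ((fun x => x ord0 i) : 'rV[R]_n -> measurableTypeR R).
Proof.
move=> _ Y mY; rewrite setTI; apply: sub_sigma_algebra => /=.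
rewrite -bigcup_seq/=; exists i => /=; first by rewrite mem_index_enum.
by exists Y => //; rewrite setTI.
Qed.

Lemma measurable_fun_rV d (T : measurableType d) (g : T -> 'rV[R]_n) :
  (forall i, measurable_fun [set: T]
     ((fun x => g x ord0 i) : T -> measurableTypeR R)) ->
  measurable_fun [set: T] g.
Proof.
move=> mg _ Y mY; rewrite setTI.
pose G : set (set 'rV[R]_n) := [set A | measurable (g @^-1` A)].
suff : measurable `<=` G by apply.
apply: smallest_sub.
  split.
  - by rewrite /G/= preimage_set0.
  - by move=> A; rewrite /G/= setTD preimage_setC; exact: measurableC.
  - by move=> F mF; rewrite /G/= preimage_bigcup; exact: bigcupT_measurable.
move=> A; rewrite -bigcup_seq => -[/= i _ [B mB <-]].
by rewrite /G/= setTI -comp_preimage -[X in measurable X]setTI; exact: mg.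
Qed.

End borel_rV.

Section lebesgue_measure_rV.
Context {R : realType}.

Section succ.
Variable n : nat.

Definition cons_rV (p : measurableTypeR R * 'rV[R]_n) : 'rV[R]_n.+1 :=
  \row_i if unlift ord0 i is Some j then p.2 ord0 j else p.1.

Definition uncons_rV (x : 'rV[R]_n.+1) : measurableTypeR R * 'rV[R]_n :=
  (x ord0 ord0, \row_j x ord0 (lift ord0 j)).

Lemma cons_rVK : cancel cons_rV uncons_rV.
Proof.
move=> [t v]; rewrite /uncons_rV /cons_rV/= mxE unlift_none; congr pair.
by apply/rowP => j; rewrite !mxE liftK.
Qed.

Lemma measurable_cons_rV : measurable_fun setT cons_rV.
Proof.
apply: measurable_fun_rV => i; case: (unliftP ord0 i) => [j|] ->.
  rewrite (_ : (fun _ => _) = (fun v : 'rV[R]_n => v ord0 j) \o snd).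
    by apply: measurableT_comp => //; exact: measurable_coord.
  by apply/funext => p; rewrite /cons_rV mxE liftK.
rewrite (_ : (fun _ => _) = fst) //.
by apply/funext => p; rewrite /cons_rV mxE unlift_none.
Qed.

Lemma measurable_uncons_rV : measurable_fun setT uncons_rV.
Proof.
apply: measurable_fun_pair; first exact: measurable_coord.
apply: measurable_fun_rV => j.
rewrite (_ : (fun _ => _) = fun x : 'rV[R]_n.+1 => x ord0 (lift ord0 j)).
  exact: measurable_coord.
by apply/funext => x; rewrite mxE.
Qed.

Variables (m1 : {sigma_finite_measure set (measurableTypeR R) -> \bar R})
          (mu : {sigma_finite_measure set 'rV[R]_n -> \bar R}).

Definition cons_measure : set 'rV[R]_n.+1 -> \bar R :=
  pushforward (m1 \x mu)%E cons_rV.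

HB.instance Definition _ := Measure.copy cons_measure
  (measure_function_pushforward__canonical__measure_function_Measure
     (m1 \x mu)%E measurable_cons_rV).

Lemma cons_measureX (A : set (measurableTypeR R)) (B : set 'rV[R]_n) :
  measurable A -> measurable B ->
  cons_measure (uncons_rV @^-1` (A `*` B)) = (m1 A * mu B)%E.
Proof.
move=> mA mB; rewrite -product_measure1E//; congr (product_measure1 _ _ _).
rewrite -comp_preimage (_ : _ \o _ = id) ?preimage_id//.
exact/funext/cons_rVK.
Qed.

Let cons_measure_sigma_finite : sigma_finite setT cons_measure.
Proof.
have /sigma_finiteP[F [TF ndF Foo]] := sigma_finiteT m1.
have /sigma_finiteP[G [TG ndG Goo]] := sigma_finiteT mu.
exists (fun k => uncons_rV @^-1` (F k `*` G k)).
  rewrite -preimage_bigcup -[LHS](preimage_setT uncons_rV); congr (_ @^-1` _).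
  rewrite -setXTT TF TG predeqE => -[x y]; split.
    move=> [/= [k _ Fkx] [l _ Gly]]; exists (maxn k l) => //; split.
    - by move: x Fkx; exact/subsetPset/ndF/leq_maxl.
    - by move: y Gly; exact/subsetPset/ndG/leq_maxr.
  by move=> [k _ []/= ? ?]; split; exists k.
move=> k; have [mF Fk] := Foo k; have [mG Gk] := Goo k; split.
  rewrite -[X in measurable X]setTI; apply: measurable_uncons_rV => //.
  exact: measurableX.
by rewrite cons_measureX// lte_mul_pinfty// ge0_fin_numE.
Qed.

HB.instance Definition _ := @Measure_isSigmaFinite.Build _ _ _
  cons_measure cons_measure_sigma_finite.

End succ.

(* Lebesgue measure on the Borel sets of R^n, as an iterated product. *)
Fixpoint lebesgue_rV (n : nat) :
    {sigma_finite_measure set 'rV[R]_n -> \bar R} :=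
  match n with
  | 0 => [the sigma_finite_measure _ _ of dirac (0 : 'rV[R]_0)]
  | m.+1 => [the sigma_finite_measure _ _ of cons_measure lebesgue_measure (lebesgue_rV m)]
  end.

Lemma lebesgue_rV_box n (A : 'I_n -> set (measurableTypeR R)) :
  (forall i, measurable (A i)) ->
  lebesgue_rV n [set x | forall i, A i (x ord0 i)] =
  (\prod_(i < n) lebesgue_measure (A i))%E.
Proof.
elim: n A => [|m IH] A mA.
  by rewrite big_ord0/= diracE mem_set// => -[].
pose B : set 'rV[R]_m := [set x | forall i, A (lift ord0 i) (x ord0 i)].
have mB : measurable B.
  have -> : B = \big[setI/setT]_(i < m)
      ((fun x : 'rV[R]_m => x ord0 i) @^-1` A (lift ord0 i)).
    apply/seteqP; split => x; rewrite -bigcap_seq.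
      by move=> Ax i _; exact: Ax.
    by move=> Ax i; apply: (Ax i); rewrite /= mem_index_enum.
  apply: bigsetI_measurable => i _; rewrite -[X in measurable X]setTI.
  exact: measurable_coord.
rewrite big_ord_recl -(IH (fun j => A (lift ord0 j)))// -cons_measureX//=.
congr (cons_measure _ _ _); apply/seteqP; split=> x.
  by move=> Ax; split=> [|j]; [exact: Ax|rewrite mxE; exact: Ax].
move=> [/= A0 AS] i; case: (unliftP ord0 i) => [j|] -> //.
by have := AS j; rewrite mxE.
Qed.

End lebesgue_measure_rV.

Section lebesgue_sets.
Context {R : realType} (n : nat).
Local Open Scope measure_scope.

(* Lebesgue outer measure on R^n, and the sigma-algebra of Lebesgue measurable
   sets (the completion of the Borel one) that it induces. *)
Definition lebesgue_outer (E : set 'rV[R]_n) : \bar R := (lebesgue_rV n)^* E.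

Definition lebesgue_measurable (E : set 'rV[R]_n) : Prop :=
  (lebesgue_rV n)^*.-cara.-measurable E.

End lebesgue_sets.

Section surface_measure.
Context {R : realType} (n : nat).

Definition enorm (x : 'rV[R]_n) : R := Num.sqrt (\sum_i x ord0 i ^+ 2).

Definition unit_sphere : set 'rV[R]_n := [set x | enorm x = 1].

Definition punctured_unit_ball : set 'rV[R]_n := [set x | 0 < enorm x <= 1].

Definition normalize (x : 'rV[R]_n) : 'rV[R]_n := (enorm x)^-1 *: x.

Lemma measurable_enorm :
  measurable_fun setT (enorm : 'rV[R]_n -> measurableTypeR R).
Proof.
rewrite (_ : enorm = (fun x => (\sum_i x ord0 i ^+ 2) `^ 2^-1)); last first.
  apply/funext => x; rewrite /enorm powR12_sqrt//.
  by apply: sumr_ge0 => i _; exact: sqr_ge0.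
apply: (measurableT_comp (measurable_powR _)).
apply: measurable_sum => i; apply: measurable_funX; exact: measurable_coord.
Qed.

Lemma measurable_punctured_unit_ball : measurable punctured_unit_ball.
Proof.
rewrite (_ : punctured_unit_ball = enorm @^-1` `]0, 1]).
  by rewrite -[X in measurable X]setTI; apply: measurable_enorm.
by apply/seteqP; split => x; rewrite /= in_itv.
Qed.

Lemma measurable_normalize : measurable_fun setT normalize.
Proof.
apply: measurable_fun_rV => i.
rewrite (_ : (fun _ => _) =
    (fun x : 'rV[R]_n => enorm x `^ (-1) * x ord0 i)); last first.
  by apply/funext => x; rewrite mxE powR_inv1// sqrtr_ge0.
apply: measurable_funM; last exact: measurable_coord.
exact: (measurableT_comp (measurable_powR _) measurable_enorm).
Qed.

(* The surface measure of the unit sphere, as a measure on R^n carried by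
   unit_sphere: the measure of A is n times the Lebesgue measure of the cone
   {r xi : 0 < r <= 1, xi in A}. This is the usual measure dS, the one for which
   dx = r^(n-1) dr dS in polar coordinates. *)
Definition surface_measure (A : set 'rV[R]_n) : \bar R :=
  (n%:R%:E * lebesgue_rV n (normalize @^-1` A `&` punctured_unit_ball))%E.

Let ball_measure := [the measure _ _ of
  mrestr (lebesgue_rV n) measurable_punctured_unit_ball].

HB.instance Definition _ := Measure.copy surface_measure
  (mscale (n%:R)%:nng
    (measure_function_pushforward__canonical__measure_function_Measure
       ball_measure measurable_normalize)).

Lemma surface_measureC_sphere : surface_measure (~` unit_sphere) = 0%E.
Proof.
rewrite /surface_measure (_ : _ `&` _ = set0) ?measure0 ?mule0//.
apply/seteqP; split => // x [/= + /andP[x0 _]]; apply.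
rewrite /unit_sphere/= /enorm /normalize.
under eq_bigr do rewrite mxE exprMn.
rewrite -mulr_sumr sqrtrM ?sqr_ge0// sqrtr_sqr ger0_norm.
  by rewrite mulVf// lt0r_neq0.
by rewrite invr_ge0 ltW.
Qed.

End surface_measure.
Arguments unit_sphere {R} n.
Arguments surface_measure {R} n.

Section complex_integral.
Context {R : realType} {d : measure_display} {T : measurableType d}.

Definition complex_integral (mu : {measure set T -> \bar R}) (D : set T)
    (g : T -> R[i]) : R[i] :=
  Rintegral mu D (fun x => complex.Re (g x)) +i*
  Rintegral mu D (fun x => complex.Im (g x)).

End complex_integral.

Section schwartz.
Context {R : realType} (n : nat).

Definition partial_derivable (i : 'I_n) (g : 'rV[R]_n -> R[i]) : Prop :=
  forall x, derivable (fun y => complex.Re (g y)) x (delta_mx ord0 i) /\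
            derivable (fun y => complex.Im (g y)) x (delta_mx ord0 i).

Definition partial (i : 'I_n) (g : 'rV[R]_n -> R[i]) : 'rV[R]_n -> R[i] :=
  fun x => 'D_(delta_mx ord0 i) (fun y => complex.Re (g y)) x +i*
           'D_(delta_mx ord0 i) (fun y => complex.Im (g y)) x.

Definition partials (b : seq 'I_n) (g : 'rV[R]_n -> R[i]) : 'rV[R]_n -> R[i] :=
  foldr partial g b.

Definition complex_continuous (g : 'rV[R]_n -> R[i]) : Prop :=
  continuous (fun x => complex.Re (g x)) /\
  continuous (fun x => complex.Im (g x)).

Definition smooth (g : 'rV[R]_n -> R[i]) : Prop :=
  forall b : seq 'I_n, complex_continuous (partials b g) /\
    forall i, partial_derivable i (partials b g).

(* Multi-indices of derivatives are given as lists of directions, multi-indices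
   of monomials as functions. *)
Definition schwartz (g : 'rV[R]_n -> R[i]) : Prop :=
  smooth g /\
  forall (a : 'I_n -> nat) (b : seq 'I_n), exists M : R,
    forall x : 'rV[R]_n,
      `| (\prod_i x ord0 i ^+ a i)%:C * partials b g x | <= M%:C.

End schwartz.

Section beam_transform.
Context {R : realType} (n : nat).

(* Euler's Gamma function at z > 0, the only values occurring below. *)
Definition Gamma (z : R) : R :=
  Rintegral lebesgue_measure `]0, +oo[ (fun t => t `^ (z - 1) * expR (- t)).

Definition c10 (s : R) : R :=
  - Gamma ((n%:R + 1 - 2 * s) / 2) /
  (2 `^ (2 * s) * pi `^ (n%:R / 2) * Gamma (s + 2^-1)).

Definition c11 (s : R) : R :=
  - Gamma ((n%:R + 2 - 2 * s) / 2) /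
  (2 `^ (2 * s - 1) * pi `^ (n%:R / 2) * Gamma s).

Definition beam (s : R) (f : 'I_n -> 'rV[R]_n -> R[i]) (x xi : 'rV[R]_n) :
    R[i] :=
  complex_integral lebesgue_measure `]0, +oo[
    (fun t : measurableTypeR R => (t `^ (2 * s - 1))%:C *
       \sum_j f j (x + (t : R) *: xi) * (xi ord0 j)%:C).

Definition A0 (s : R) (f : 'I_n -> 'rV[R]_n -> R[i]) (x : 'rV[R]_n) : R[i] :=
  (c10 s)%:C * complex_integral (surface_measure n) (unit_sphere n) (beam s f x).

Definition A1 (s : R) (f : 'I_n -> 'rV[R]_n -> R[i]) (i : 'I_n)
    (x : 'rV[R]_n) : R[i] :=
  (c11 s)%:C * complex_integral (surface_measure n) (unit_sphere n)
    (fun xi => (xi ord0 i)%:C * beam s f x xi).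

End beam_transform.

(* Main.v *)
(* In polar coordinates, A^0 f(x) and A^1 f(x) are, up to nonzero constants, the
   integrals of f_j(x+y) against y_j |y|^(2s-1-n) and y_i y_j |y|^(2s-2-n). These
   kernels are derivatives of powers of |y|, so integrating by parts near a point
   where f vanishes turns A^0 f into a Riesz potential of div f with kernel
   |y|^(2s+1-n), and, once div f = 0, A^1 f into that of f with kernel |y|^(2s-n).
   Both potentials obey unique continuation: let F(x) be the integral of
   h(x+y) |y|^p, with h = 0 on U. At almost every zero of F in U all derivatives
   of F vanish, since a zero where a partial derivative does not vanish is isolated
   in that direction. Fix such a point x in E. The derivatives of h are orthogonal
   to |y|^p, hence h is orthogonal to all derivatives of |y|^p. In terms of the
   inversion w = y/|y|^2 these derivatives span |y|^p times all polynomials in w,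
   as long as p and p+n-1 avoid certain integers; this is where s <> 1/2 is used.
   As h vanishes near x, w stays bounded on the support of h, so powers of a
   polynomial in w peaked at a given point show that h vanishes there. *)
Require Import Defs.
From HB Require Import structures.
From mathcomp Require Import all_boot all_order all_algebra.
From mathcomp Require Import complex.
From mathcomp Require Import all_classical all_reals all_analysis.
From mathcomp Require Import measurable_realfun.
From mathcomp Require Import ring lra.
Import Order.TTheory GRing.Theory Num.Theory.
Import numFieldNormedType.Exports.
Local Open Scope classical_set_scope.
Local Open Scope ring_scope.

Set Implicit Arguments.
Unset Strict Implicit.
Unset Printing Implicit Defensive.

(** * Lebesgue measure on R^n *)

(** Two obstacles shape the development. The kernels are singular at the origin; therefore every
    integral is written at a base point x of U, with the translate of h, which vanishes near 0, and
    kernels are bounded only outside a ball. And E is merely a set of positive measure; therefore F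
    is examined only through its zeros and through difference quotients with steps 1/(j+1). This
    yields countably many exceptional sets, each null by packing disjoint translates into a cube. A
    function comes as a family [D b] over lists of directions, where [D (i :: b)] is the i-th
    partial derivative of [D b]. The arguments use only this relation, continuity and decay, so they
    apply alike to real and imaginary parts, to translates and to the divergence. Powers of |y| are
    written as powers k of [N2], the squared norm, so p = 2k. For the divergence p + n - 1 = 2s, and
    for the components it is 2s - 1; the exclusion of s = 1/2 is felt in the first case. *)

Section lebesgue_affine.
Context {R : realType}.
Local Open Scope ereal_scope.
Local Notation leb := (@lebesgue_measure R).

Lemma measurable_affine1 (c v : R) :
  measurable_fun [set: measurableTypeR R]
    ((fun t => c * t + v)%R : measurableTypeR R -> measurableTypeR R).
Proof. by apply: measurable_funD => //; exact: measurable_funM. Qed.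

(** The image of Lebesgue measure under the affine map, scaled by c, agrees with Lebesgue measure on
    half-open intervals, and these determine it. *)
Lemma lebesgue_measure_affine (c v : R) (A : set (measurableTypeR R)) :
  (0 < c)%R -> measurable A ->
  leb A = c%:E * leb ((fun t => c * t + v)%R @^-1` A).
Proof.
move=> c0 mA.
pose k : {nonneg R} := NngNum (ltW c0).
pose m' := [the measure _ _ of mscale k
  (measure_function_pushforward__canonical__measure_function_Measure leb
    (measurable_affine1 c v))].
suff H : forall X, ocitv X -> leb X = m' X.
  by rewrite (lebesgue_measure_unique H mA).
move=> _ [[a b] _ <-]; rewrite /m' /= /mscale /= /pushforward.
have -> : (fun t => c * t + v)%R @^-1` `]a, b]%classic =
    `]((a - v) / c)%R, ((b - v) / c)%R]%classic.
  apply/seteqP; split => t /=; rewrite !in_itv/= => /andP[h1 h2].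
    by rewrite ltr_pdivrMr// ler_pdivlMr//; apply/andP; split; lra.
  by move: h1 h2; rewrite ltr_pdivrMr// ler_pdivlMr// => h1 h2; apply/andP; split; lra.
have -> : leb `]a, b]%classic = if (a < b)%R then (b - a)%:E else 0.
  by rewrite lebesgue_measure_itv/= lte_fin EFinB.
have -> : leb `]((a - v) / c)%R, ((b - v) / c)%R]%classic =
    if ((a - v) / c < (b - v) / c)%R then ((b - v) / c - (a - v) / c)%:E else 0.
  by rewrite lebesgue_measure_itv/= lte_fin EFinB.
rewrite ltr_pM2r ?invr_gt0// ltrD2r.
case: ifP => _; last by rewrite mule0.
by rewrite -EFinM; congr EFin; field; rewrite gt_eqF.
Qed.

Lemma ge0_integral_affine1 (c v : R) (f : R -> \bar R) : (0 < c)%R ->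
  measurable_fun [set: measurableTypeR R] (f : measurableTypeR R -> \bar R) ->
  (forall t, 0 <= f t) ->
  c%:E * \int[leb]_t f (c * t + v)%R = \int[leb]_t f t.
Proof.
move=> c0 mf f0.
pose k : {nonneg R} := NngNum (ltW c0).
pose m1 := measure_function_pushforward__canonical__measure_function_Measure leb
    (measurable_affine1 c v).
pose m' := [the measure _ _ of mscale k m1].
have -> : \int[leb]_t f t = \int[m']_t f t.
  apply: eq_measure_integral => A mA _.
  by first [exact: lebesgue_measure_affine | exact/esym/lebesgue_measure_affine].
rewrite [RHS](@ge0_integral_mscale _ _ _ m1 setT measurableT k)//.
congr (_ * _).
rewrite (@ge0_integral_pushforward _ _ _ _ _ _ (measurable_affine1 c v) leb setT f)//.
Qed.

Lemma ge0_integral_lebesgue_rVS n (f : 'rV[R]_n.+1 -> \bar R) :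
  measurable_fun setT f -> (forall y, 0 <= f y) ->
  \int[lebesgue_rV n.+1]_y f y =
  \int[leb]_t \int[lebesgue_rV n]_y f (cons_rV (t, y)).
Proof.
move=> mf f0.
rewrite [LHS](@ge0_integral_pushforward _ _ _ _ _ _
  (@measurable_cons_rV R n) (leb \x lebesgue_rV n) setT f)//.
rewrite preimage_setT fubini_tonelli1//; first last.
  by move=> p; exact: f0.
by apply: measurableT_comp => //; exact: measurable_cons_rV.
Qed.

Lemma measurable_affine n (c : R) (v : 'rV[R]_n) :
  measurable_fun setT (fun y : 'rV[R]_n => (c *: y + v)%R).
Proof.
apply: measurable_fun_rV => i.
under eq_fun do rewrite !mxE.
apply: measurable_funD => //; apply: measurable_funM => //.
exact: measurable_coord.
Qed.

(** Induction on n by Tonelli: each coordinate contributes one factor c. *)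
Lemma ge0_integral_affine n (c : R) (v : 'rV[R]_n) (f : 'rV[R]_n -> \bar R) :
  (0 < c)%R -> measurable_fun setT f -> (forall y, 0 <= f y) ->
  (c ^+ n)%:E * \int[lebesgue_rV n]_y f (c *: y + v)%R =
  \int[lebesgue_rV n]_y f y.
Proof.
move=> c0; elim: n v f => [|n IH] v f mf f0.
  rewrite expr0 mul1e; apply: eq_integral => y _; congr f.
  by apply/rowP => -[].
rewrite !ge0_integral_lebesgue_rVS//; last first.
  by apply: measurableT_comp => //; exact: measurable_affine.
have mg : measurable_fun setT
    (fun p : measurableTypeR R * 'rV[R]_n => f (cons_rV p)).
  by apply: measurableT_comp => //; exact: measurable_cons_rV.
pose F (t : measurableTypeR R) := \int[lebesgue_rV n]_y f (cons_rV (t, y)).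
have mF : measurable_fun setT F by exact: (measurable_fun_fubini_tonelli_F _ mg).
have F0 t : 0 <= F t by exact: integral_ge0.
rewrite -(@ge0_integral_affine1 c (v ord0 ord0) F)// exprS EFinM -muleA.
congr (_ * _).
rewrite -ge0_integralZl ?lee_fin ?exprn_ge0 ?ltW//.
- apply: eq_integral => t _; rewrite /F.
  rewrite -[RHS](IH (\row_j v ord0 (lift ord0 j))%R) //; last first.
    exact: (measurableT_comp mg (pair1_measurable (c * t + v ord0 ord0 : measurableTypeR R)%R)).
  congr (_ * _); apply: eq_integral => y _; congr f.
  apply/rowP => i; rewrite !mxE; case: unliftP => [j|] -> /=.
    by rewrite !mxE.
  by [].
- have mh : measurable_fun setT (fun p : measurableTypeR R * 'rV[R]_n =>
      f (c *: cons_rV p + v)%R).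
    by apply: measurableT_comp => //; apply: measurableT_comp (measurable_affine c v) _; exact: measurable_cons_rV.
  exact: (measurable_fun_fubini_tonelli_F _ mh).
- by move=> t _; exact: integral_ge0.
Qed.

Lemma integral_translate n (v : 'rV[R]_n) (f : 'rV[R]_n -> \bar R) :
  measurable_fun setT f ->
  \int[lebesgue_rV n]_y f (y + v)%R = \int[lebesgue_rV n]_y f y.
Proof.
move=> mf; rewrite [LHS]integralE [RHS]integralE.
have H (g : 'rV[R]_n -> \bar R) : measurable_fun setT g -> (forall y, 0 <= g y) ->
    \int[lebesgue_rV n]_y g (y + v)%R = \int[lebesgue_rV n]_y g y.
  move=> mg g0; rewrite -[RHS](@ge0_integral_affine n 1%R v)// expr1n mul1e.
  by under [in RHS]eq_integral do rewrite scale1r.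
congr (_ - _).
  rewrite -[RHS]H//; last exact: measurable_funepos.
  by apply: eq_integral => y _; rewrite !funeposE.
rewrite -[RHS]H//; last exact: measurable_funeneg.
by apply: eq_integral => y _; rewrite !funenegE.
Qed.

Lemma lebesgue_rV_translate n (v : 'rV[R]_n) (A : set 'rV[R]_n) :
  measurable A -> lebesgue_rV n ((fun y => y + v)%R @^-1` A) = lebesgue_rV n A.
Proof.
move=> mA.
have mB : measurable ((fun y => y + v)%R @^-1` A).
  rewrite -[X in measurable X]setTI.
  have := measurable_affine 1 v measurableT mA.
  by congr measurable; congr (_ `&` _); apply/seteqP; split => y /=; rewrite scale1r.
have E B : measurable B -> lebesgue_rV n B = \int[lebesgue_rV n]_y (\1_B y)%:E.
  by move=> mB'; rewrite integral_indic// setIT.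
rewrite !E// -[RHS](@integral_translate n v)//.
exact/measurable_EFinP/measurable_indic.
Qed.

Lemma integrable_oneDsqrV : leb.-integrable setT (fun t : R => ((1 + t ^+ 2)^-1)%:E).
Proof.
apply/integrableP; split.
  by apply/measurable_EFinP; apply: continuous_measurable_fun => x; exact: continuous_oneDsqrV.
have p0 (t : R) : (0 <= (1 + t ^+ 2)^-1)%R by rewrite invr_ge0; have := sqr_ge0 t; lra.
rewrite (eq_integral (fun t : measurableTypeR R => ((1 + t ^+ 2)^-1)%:E)); last first.
  by move=> t _ /=; rewrite ger0_norm.
rewrite (@ge0_symfun_integralT _ (fun t => (1 + t ^+ 2)^-1)%R)//.
- by rewrite -set_itvcy integral0y_oneDsqr -EFinM ltry.
- by move=> x; exact: continuous_oneDsqrV.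
- by move=> t /=; rewrite sqrrN.
Qed.

(** The common integrable majorant in the dominated convergence and decay arguments; as a product of
    functions of one variable its integral factors. *)
Definition weight n (y : 'rV[R]_n) : R := (\prod_i (1 + y ord0 i ^+ 2)^-1)%R.

Lemma weight_gt0 n (y : 'rV[R]_n) : (0 < weight y)%R.
Proof.
apply: prodr_gt0 => i _; rewrite invr_gt0.
by have := sqr_ge0 (y ord0 i); lra.
Qed.

Lemma measurable_weight n : measurable_fun setT (@weight n).
Proof.
apply: measurable_prod => i _.
have mc : measurable_fun [set: 'rV[R]_n]
    ((fun x => x ord0 i) : 'rV[R]_n -> measurableTypeR R) by exact: measurable_coord.
rewrite (_ : (fun _ => _) = (fun x : R => (1 + x ^+ 2)^-1%R) \o (fun y : 'rV[R]_n => y ord0 i)) //.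
apply: (measurableT_comp _ mc).
apply: continuous_measurable_fun => x.
exact: continuous_oneDsqrV.
Qed.

Lemma integrable_weight n : (lebesgue_rV n).-integrable setT (EFin \o @weight n).
Proof.
apply/integrableP; split; first by apply/measurable_EFinP; exact: measurable_weight.
rewrite (eq_integral (fun y => (weight y)%:E)); last first.
  by move=> y _; rewrite /= ger0_norm// ltW ?weight_gt0.
elim: n => [|n IH].
  rewrite (eq_integral (cst 1)); last first.
    by move=> y _; rewrite /weight big_ord0.
  by rewrite integral_cst// mul1e /= diracT ltry.
rewrite ge0_integral_lebesgue_rVS//; first last.
- by move=> y; rewrite lee_fin ltW ?weight_gt0.
- by apply/measurable_EFinP; exact: measurable_weight.
have E t : \int[lebesgue_rV n]_y (weight (cons_rV (t, y)))%:E =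
    (1 + t ^+ 2)^-1%:E * \int[lebesgue_rV n]_y (weight y)%:E.
  rewrite -ge0_integralZl//.
  - apply: eq_integral => y _; rewrite -EFinM; congr EFin.
    rewrite /weight big_ord_recl !mxE unlift_none; congr (_ * _)%R.
    by apply: eq_bigr => i _; rewrite !mxE liftK.
  - by apply/measurable_EFinP; exact: measurable_weight.
  - by move=> y _; rewrite lee_fin ltW ?weight_gt0.
  - by rewrite lee_fin invr_ge0; have := sqr_ge0 t; lra.
under eq_integral do rewrite E.
have mV : measurable_fun [set: measurableTypeR R] (fun t : R => (1 + t ^+ 2)^-1%:E).
  by apply/measurable_EFinP; apply: continuous_measurable_fun => x; exact: continuous_oneDsqrV.
rewrite ge0_integralZr//; first last.
- by apply: integral_ge0 => y _; rewrite lee_fin ltW ?weight_gt0.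
- by move=> t _; rewrite lee_fin invr_ge0; have := sqr_ge0 t; lra.
rewrite lte_mul_pinfty//.
- by apply: integral_ge0 => t _; rewrite lee_fin invr_ge0; have := sqr_ge0 t; lra.
- exact: (integrable_fin_num measurableT integrable_oneDsqrV).
Qed.
End lebesgue_affine.

(** * Polar coordinates *)

Section polar.
Context {R : realType}.
Local Open Scope ereal_scope.
Local Notation leb := (@lebesgue_measure R).

Lemma enormZ n (c : R) (y : 'rV[R]_n) : enorm (c *: y) = (`|c| * enorm y)%R.
Proof.
rewrite /enorm; under eq_bigr do rewrite mxE exprMn.
by rewrite -mulr_sumr sqrtrM ?sqr_ge0// sqrtr_sqr.
Qed.

Lemma enorm_ge0 n (y : 'rV[R]_n) : (0 <= enorm y)%R.
Proof. exact: sqrtr_ge0. Qed.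

Lemma enorm_sqr n (y : 'rV[R]_n) : (enorm y ^+ 2 = \sum_i y ord0 i ^+ 2)%R.
Proof. by rewrite sqr_sqrtr//; apply: sumr_ge0 => i _; exact: sqr_ge0. Qed.

Lemma enorm_eq0 n (y : 'rV[R]_n) : (enorm y == 0%R) = (y == 0%R).
Proof.
apply/eqP/eqP => [y0|->]; last first.
  rewrite /enorm big1 ?sqrtr0// => i _; by rewrite mxE expr0n.
apply/rowP => i; rewrite mxE; apply/eqP; rewrite -sqrf_eq0; apply/eqP.
have : (\sum_i y ord0 i ^+ 2 = 0)%R by rewrite -enorm_sqr y0 expr0n.
move/eqP; rewrite psumr_eq0 => [/allP/(_ i)|j _]; last exact: sqr_ge0.
by rewrite mem_index_enum => /(_ isT) /eqP.
Qed.

Lemma measurable_scale_rV n : measurable_fun setT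
  (fun p : measurableTypeR R * 'rV[R]_n => (p.1 : R) *: p.2).
Proof.
apply: measurable_fun_rV => i; under eq_fun do rewrite mxE.
apply: measurable_funM => //.
exact: (measurableT_comp (measurable_coord i) measurable_snd).
Qed.

Lemma measurable_box n (A : 'I_n -> set (measurableTypeR R)) :
  (forall i, measurable (A i)) ->
  measurable [set y : 'rV[R]_n | forall i, A i (y ord0 i)].
Proof.
move=> mA.
have -> : [set y : 'rV[R]_n | forall i, A i (y ord0 i)] = \big[setI/setT]_(i < n)
    ((fun y : 'rV[R]_n => y ord0 i) @^-1` A i).
  apply/seteqP; split => y; rewrite -bigcap_seq.
    by move=> Ay i _; exact: Ay.
  by move=> Ay i; apply: (Ay i); rewrite /= mem_index_enum.
apply: bigsetI_measurable => i _; rewrite -[X in measurable X]setTI.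
exact: (measurable_coord i measurableT (mA i)).
Qed.

Lemma lebesgue_rV_set1 n (x : 'rV[R]_n) : (0 < n)%N ->
  measurable [set x] /\ lebesgue_rV n [set x] = 0.
Proof.
move=> n0.
have E : [set x] = [set y | forall i, [set x ord0 i] (y ord0 i)].
  by apply/seteqP; split => [y -> //|y /= h]; apply/rowP => i; exact: h.
split; last first.
  rewrite E (lebesgue_rV_box (A := fun i => [set x ord0 i])); last first.
    by move=> i; exact: measurable_set1.
  by case: n n0 x E => // n _ x E; rewrite big_ord_recl lebesgue_measure_set1 mul0e.
rewrite E; apply: (measurable_box (A := fun i => [set x ord0 i])) => i.
exact: measurable_set1.
Qed.

Lemma measurable_unit_sphere n : measurable (@unit_sphere R n).
Proof.
rewrite (_ : unit_sphere n = @enorm R n @^-1` [set 1%R])//.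
rewrite -[X in measurable X]setTI.
exact: (measurable_enorm measurableT (measurable_set1 (1%R : R))).
Qed.

Lemma ge0_integral_surface n (F : 'rV[R]_n -> \bar R) :
  measurable_fun setT F -> (forall y, 0 <= F y) ->
  \int[surface_measure n]_(xi in unit_sphere n) F xi =
  n%:R%:E * \int[lebesgue_rV n]_(y in @punctured_unit_ball R n) F (normalize y).
Proof.
move=> mF F0.
have mS := @measurable_unit_sphere n.
pose mb := [the measure _ _ of
  mrestr (lebesgue_rV n) (@measurable_punctured_unit_ball R n)].
pose m1 := measure_function_pushforward__canonical__measure_function_Measure mb
  (@measurable_normalize R n).
pose k : {nonneg R} := NngNum (ler0n R n).
have -> : \int[surface_measure n]_(xi in unit_sphere n) F xi =
   \int[mscale k m1]_(xi in unit_sphere n) F xi by exact: eq_measure_integral.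
rewrite (@ge0_integral_mscale _ _ _ m1)//; last exact: measurable_funTS.
congr (_ * _).
rewrite (@ge0_integral_pushforward _ _ _ _ _ _ (@measurable_normalize R n) mb _ F)//; last exact: measurable_funTS.
have mN : measurable (@normalize R n @^-1` unit_sphere n : set 'rV[R]_n).
  by rewrite -[X in measurable X]setTI; exact: measurable_normalize.
have mFn : measurable_fun setT (F \o @normalize R n).
  by apply: measurableT_comp => //; exact: measurable_normalize.
have BN : @punctured_unit_ball R n `<=` @normalize R n @^-1` unit_sphere n.
  move=> y /andP[y0 _]; rewrite /unit_sphere/= /normalize enormZ.
  by rewrite ger0_norm ?invr_ge0 ?ltW// mulVf// gt_eqF.
have mB := @measurable_punctured_unit_ball R n.
pose N := @normalize R n @^-1` unit_sphere n `\` @punctured_unit_ball R n.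
rewrite (@ge0_negligible_integral _ _ _ mb _ N)//; last 4 first.
- exact: measurableD.
- exact: measurable_funTS.
- by move=> y _; exact: F0.
- rewrite /mb/= /mrestr /N.
  by rewrite setDE -setIA setICl setI0 measure0.
rewrite /N setDD (setIidr BN).
apply: eq_measure_integral => A mA AB.
by rewrite /mb/= /mrestr (setIidl AB).
Qed.

End polar.

Section polar_coordinates.
Context {R : realType}.
Local Open Scope ereal_scope.
Local Notation leb := (@lebesgue_measure R).

Lemma integral_indicM d (T : measurableType d) (mu : {measure set T -> \bar R})
    (D : set T) (f : T -> \bar R) :
  \int[mu]_(x in D) f x = \int[mu]_x ((\1_D x)%:E * f x).
Proof.
rewrite integral_mkcond; apply: eq_integral => x _.
by rewrite patchE indicE; case: ifP => _; rewrite ?mul1e ?mul0e.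
Qed.

(** The radial integral that remains at the end of [ge0_integral_polar]; an antiderivative is - r^n
    t^(-n). *)
Lemma integral_inv_pow n (r : R) : (0 < n)%N -> (0 < r)%R ->
  \int[leb]_(t in `[r, +oo[) (n%:R * r ^+ n * t ^- n.+1)%:E = 1.
Proof.
move=> n0 r0.
pose F (t : R) := (- r ^+ n * t ^- n)%R.
have dF (t : R) : (0 < t)%R -> is_derive t (1%R : R) F (n%:R * r ^+ n * t ^- n.+1)%R.
  move=> t0; have tn0 : (t ^+ n != 0)%R by rewrite expf_neq0// gt_eqF.
  have H : is_derive t (1%R : R) (fun x : R => x ^+ n)%R (n%:R *: t ^+ n.-1 *: 1)%R.
    by apply: DeriveDef; [exact: exprn_derivable|exact: exp_derive].
  have H1 := is_deriveZ (- r ^+ n)%R (@is_deriveV R (fun x : R => x ^+ n)%R t _ 1%R tn0 H).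
  apply: (is_derive_eq H1).
  rewrite /GRing.scale /= mulr1.
  clear H1 H F; case: n n0 tn0 => // n _ tn0 /=.
  have tn : (t ^+ n != 0)%R by rewrite expf_neq0// gt_eqF.
  have tz : (t != 0)%R by rewrite gt_eqF.
  rewrite !exprS; field; rewrite ?tn ?tz//.
rewrite (@ge0_continuous_FTC2y _ _ F r 0%R).
- rewrite /F mulNr divff ?expf_neq0 ?gt_eqF//.
  by rewrite -EFinB opprK add0r.
- move=> x rx; rewrite !mulr_ge0 ?invr_ge0 ?exprn_ge0 ?ler0n ?(ltW r0)//.
  by rewrite (le_trans _ rx) ?ltW.
- have cf (t : R) : (0 < t)%R ->
      {for t, continuous (fun t : R => n%:R * r ^+ n * t ^- n.+1)%R}.
    move=> t0; apply: cvgM; first exact: cvg_cst.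
    by apply: cvgV; [rewrite expf_neq0// gt_eqF|exact: exprn_continuous].
  apply/continuous_within_itvcyP; split=> [x rx|]; first by apply: cf; move: rx; rewrite in_itv/= andbT; exact: lt_trans.
  by apply: cvg_at_right_filter; exact: cf.
- rewrite /F -(mulr0 (- r ^+ n))%R; apply: cvgM; first exact: cvg_cst.
  apply/gtr0_cvgV0; first by exists 0%R; split; [exact: num_real|move=> x x0; rewrite exprn_gt0].
  apply/cvgryPge => A; exists (Num.max 1 A)%R; split => [|x]; first exact: num_real.
  rewrite gt_max => /andP[x1 Ax]; rewrite (le_trans (ltW Ax))// -[leLHS]expr1.
  by rewrite ler_weXn2l// ltW.
- by move=> x rx; have [] := dF x (lt_trans r0 rx).
- apply: cvg_at_right_filter; apply: differentiable_continuous.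
  by apply/derivable1_diffP; have [] := dF r r0.
- move=> x; rewrite in_itv/= andbT => rx.
  by rewrite derive1E; have [_ ->] := dF x (lt_trans r0 rx).
Qed.

(** Only scaling and Tonelli enter. Let Phi(xi) be the inner integral. Replacing t by |y| t gives
    Phi(y/|y|) = |y|^n Phi(y), so the left side is the integral of n |y|^n t^(n-1) G(t y) over t > 0
    and y in the punctured ball ([P]). For fixed t, the substitution z = t y turns this into n |z|^n
    t^(-n-1) G(z) on 0 < |z| <= t ([Q], [C]), and the integral over t >= |z| of the factor before
    G(z) is 1. *)
Lemma ge0_integral_polar n (G : 'rV[R]_n -> \bar R) : (0 < n)%N ->
  measurable_fun setT G -> (forall y, 0 <= G y) ->
  \int[surface_measure n]_(xi in unit_sphere n)
    \int[leb]_(t in `]0%R, +oo[) ((t ^+ n.-1)%:E * G (t *: xi)) =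
  \int[lebesgue_rV n]_y G y.
Proof.
move=> n0 mG G0.
pose I : set (measurableTypeR R) := `]0%R, +oo[%classic.
have mI : measurable I by exact: measurable_itv.
have mGs : measurable_fun setT
    (fun p : measurableTypeR R * 'rV[R]_n => G ((p.1 : R) *: p.2)).
  by apply: measurableT_comp => //; exact: measurable_scale_rV.
have mB := @measurable_punctured_unit_ball R n.
pose k (p : measurableTypeR R * 'rV[R]_n) : \bar R :=
  (\1_I p.1 * p.1 ^+ n.-1)%:E * G ((p.1 : R) *: p.2).
have mk : measurable_fun setT k.
  apply: emeasurable_funM => //; apply/measurable_EFinP.
  apply: measurable_funM.
    apply: (measurableT_comp (f := (\1_I : measurableTypeR R -> R))) => //.
  by apply: measurable_funX.
have k0 p : 0 <= k p.
  apply: mule_ge0 => //; rewrite lee_fin indicE.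
  case: (boolP (p.1 \in I)) => [|_]; last by rewrite mul0r.
  by rewrite inE /I/= in_itv/= andbT => /ltW p0; rewrite mul1r exprn_ge0.
pose Phi (xi : 'rV[R]_n) := \int[leb]_t k (t, xi).
have mPhi : measurable_fun setT Phi.
  exact: (measurable_fun_fubini_tonelli_G _ mk).
have Phi0 xi : 0 <= Phi xi by exact: integral_ge0.
transitivity (\int[surface_measure n]_(xi in unit_sphere n) Phi xi).
  apply: eq_integral => xi _; rewrite integral_indicM; apply: eq_integral => t _.
  by rewrite muleA -EFinM.
rewrite ge0_integral_surface//.
have PhiN y : @punctured_unit_ball R n y ->
    Phi (normalize y) = (enorm y ^+ n)%:E * Phi y.
  move=> /andP[y0 _]; rewrite /Phi.
  rewrite -(@ge0_integral_affine1 _ (enorm y) 0%R (fun t => k (t, normalize y)))//; last first.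
    by apply: (measurableT_comp mk); exact: pair2_measurable.
  have -> : (enorm y ^+ n = enorm y * enorm y ^+ n.-1)%R by rewrite -exprS prednK.
  rewrite EFinM -muleA; congr (_ * _).
  rewrite -ge0_integralZl//.
  - apply: eq_integral => t _; rewrite /k/= muleA -EFinM; congr (_%:E * G _).
      rewrite addr0 exprMn !indicE.
      have -> : ((enorm y * t)%R \in I) = (t \in I).
        by apply/idP/idP; rewrite !inE /I/= !in_itv/= !andbT pmulr_rgt0.
      by ring.
    rewrite addr0 /normalize scalerA mulrAC divff ?mul1r// gt_eqF//.
  - by apply: (measurableT_comp mk); exact: pair2_measurable.
  - by rewrite lee_fin exprn_ge0// ltW.
pose P (p : measurableTypeR R * 'rV[R]_n) : \bar R :=
  (n%:R * \1_(@punctured_unit_ball R n) p.2 * enorm p.2 ^+ n)%:E * k p.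
have menorm2 : measurable_fun setT
    (fun p : measurableTypeR R * 'rV[R]_n => enorm p.2).
  exact: (measurableT_comp (@measurable_enorm R n) measurable_snd).
have mP : measurable_fun setT P.
  apply: emeasurable_funM => //; apply/measurable_EFinP.
  apply: measurable_funM; last exact: measurable_funX.
  apply: measurable_funM => //.
  exact: (measurableT_comp (measurable_indic mB) measurable_snd).
have P0 p : 0 <= P p.
  by apply: mule_ge0 => //; rewrite lee_fin !mulr_ge0 ?exprn_ge0 ?enorm_ge0.
have mk2 y : measurable_fun setT (fun t => k (t, y)).
  by apply: (measurableT_comp mk); exact: pair2_measurable.
pose g y := (\1_(@punctured_unit_ball R n) y)%:E * Phi (normalize y).
have mPn : measurable_fun setT (Phi \o @normalize R n).
  by apply: measurableT_comp => //; exact: measurable_normalize.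
have mg : measurable_fun setT g.
  by apply: emeasurable_funM => //; apply/measurable_EFinP; exact: measurable_indic.
have g0 y : 0 <= g y by apply: mule_ge0.
transitivity (\int[lebesgue_rV n]_y \int[leb]_t P (t, y)).
  rewrite integral_indicM -(ge0_integralZl _ _ mg)//.
  apply: eq_integral => y _.
  have -> : \int[leb]_t P (t, y) =
      (n%:R * \1_(@punctured_unit_ball R n) y * enorm y ^+ n)%:E * Phi y.
    rewrite /Phi -(ge0_integralZl _ _ (mk2 y))//.
    by rewrite lee_fin !mulr_ge0 ?exprn_ge0 ?enorm_ge0.
  rewrite /g indicE; case: (boolP (y \in _)) => yB; last by rewrite !(mul0e,mule0,mul0r,mulr0).
  rewrite PhiN; last exact: set_mem.
  by rewrite mul1e mulr1 muleA EFinM.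
rewrite -(@fubini_tonelli _ _ _ _ _ leb (lebesgue_rV n) P mP P0).
pose C := [set q : measurableTypeR R * 'rV[R]_n | ((0 < enorm q.2) && (enorm q.2 <= q.1))%R].
have mC : measurable C.
  rewrite (_ : C = [set q | (cst 0 q < enorm q.2)%R] `&` [set q | (enorm q.2 <= q.1)%R]); last first.
    by apply/seteqP; split => q /=; [move/andP|move=> ?; apply/andP].
  apply: measurableI.
    have := @measurable_fun_ltr _ _ _ setT _ _ (measurable_cst (0%R : R)) menorm2.
    by move=> /(_ measurableT [set true]); rewrite setTI; apply.
  have := @measurable_fun_ler _ _ _ setT _ _ menorm2 measurable_fst.
  by move=> /(_ measurableT [set true]); rewrite setTI; apply.
pose Q (p : measurableTypeR R * 'rV[R]_n) : \bar R :=
  (\1_C p * (n%:R * enorm p.2 ^+ n * p.1 `^ (- n.+1%:R)))%:E * G p.2.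
have mQ : measurable_fun setT Q.
  apply: emeasurable_funM => //; last exact: (measurableT_comp mG measurable_snd).
  apply/measurable_EFinP; apply: measurable_funM; first exact: measurable_indic.
  apply: measurable_funM; first by apply: measurable_funM => //; exact: measurable_funX.
  exact: (measurableT_comp (measurable_powR _) measurable_fst).
have Q0 p : 0 <= Q p.
  rewrite /Q indicE; case: (boolP (p \in C)) => pC; last by rewrite mul0r mul0e.
  move: pC; rewrite inE => /andP[p1 p2]; apply: mule_ge0 => //.
  by rewrite lee_fin mul1r !mulr_ge0 ?powR_ge0 ?exprn_ge0 ?enorm_ge0 ?ler0n.
transitivity (\int[leb]_t \int[lebesgue_rV n]_y Q (t, y)).
  apply: eq_integral => t _; have [t0|t0] := ltP 0%R t; last first.
    apply: eq_integral => y _; rewrite /P /Q /k /= !indicE.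
    have -> : t \in I = false.
      by apply/negP; rewrite inE /I/= in_itv/= andbT ltNge t0.
    have -> : (t, y) \in C = false.
      apply/negP; rewrite inE /C/= => /andP[y0 yt].
      by move: (lt_le_trans y0 yt); rewrite ltNge t0.
    by rewrite !mul0r mul0e mule0 mul0e.
  have mQt : measurable_fun setT (fun y => Q (t, y)).
    by apply: (measurableT_comp mQ); exact: pair1_measurable.
  rewrite -(@ge0_integral_affine _ n t 0%R (fun z => Q (t, z)) t0)//.
  have mQt' : measurable_fun setT (fun y : 'rV[R]_n => Q (t, (t : R) *: y + 0)%R).
    by apply: (measurableT_comp mQt); exact: measurable_affine.
  rewrite -(ge0_integralZl _ _ mQt')//; last by rewrite lee_fin exprn_ge0// ltW.
  apply: eq_integral => y _; rewrite /P /Q /k /= addr0 enormZ ger0_norm ?ltW//.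
  rewrite !muleA -!EFinM; congr (_%:E * _); rewrite !indicE (powR_invn _ (ltW t0)).
  have -> : t \in I by rewrite inE /I/= in_itv/= andbT.
  have -> : ((t, t *: y)%R \in C) = (y \in @punctured_unit_ball R n).
    have e : ((0 < t * enorm y) && (t * enorm y <= t))%R =
        ((0 < enorm y) && (enorm y <= 1))%R by rewrite pmulr_rgt0// ger_pMr.
    by apply/idP/idP; rewrite !inE /C /punctured_unit_ball/= enormZ (ger0_norm (ltW t0)) e.
  clear -n0 t0; case: n n0 y => // m _ y; rewrite exprMn !exprS /=.
  have tm : (t ^+ m != 0)%R by rewrite expf_neq0// gt_eqF.
  have tz : (t != 0)%R by rewrite gt_eqF.
  by field; rewrite ?tm ?tz.
rewrite (@fubini_tonelli _ _ _ _ _ leb (lebesgue_rV n) Q mQ Q0).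
(* At z = 0 the integral over t is 0 instead of G(0); the origin is a null set because n > 0. *)
have [m0 z0] := lebesgue_rV_set1 (0%R : 'rV[R]_n) n0.
rewrite [RHS](@ge0_negligible_integral _ _ _ _ _ [set (0%R : 'rV[R]_n)])//.
rewrite integral_indicM; apply: eq_integral => z _; rewrite indicE.
case: (eqVneq z 0%R) => [->|zn0].
  have -> : (0%R : 'rV[R]_n) \in [set: 'rV[R]_n] `\ 0%R = false.
    by apply/negP; rewrite inE => -[_ ]; apply.
  rewrite mul0e; apply: integral0_eq => t _.
  rewrite /Q indicE.
  have -> : (t, 0%R : 'rV[R]_n) \in C = false.
    apply/negP; rewrite inE /C/= => /andP[+ _].
    have -> : enorm (0%R : 'rV[R]_n) = 0%R by apply/eqP; rewrite enorm_eq0.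
    by rewrite ltxx.
  by rewrite mul0r mul0e.
have -> : z \in [set: 'rV[R]_n] `\ 0%R by rewrite inE; split => //; exact/eqP.
have zpos : (0 < enorm z)%R by rewrite lt_def enorm_ge0 enorm_eq0 zn0.
rewrite mul1e -[RHS]mul1e -(@integral_inv_pow n (enorm z) n0 zpos).
have -> : \int[leb]_(t in `[enorm z, +oo[) (n%:R * enorm z ^+ n * t ^- n.+1)%:E =
  \int[leb]_(t in `[enorm z, +oo[) (n%:R * enorm z ^+ n * t `^ (- n.+1%:R))%:E.
  apply: eq_integral => t; rewrite inE/= in_itv/= andbT => zt.
  by rewrite powR_invn// (le_trans _ zt)// ltW.
rewrite [X in _ = X * _]integral_indicM.
set h := (fun t : measurableTypeR R => (\1_`[enorm z, +oo[%classic t)%:E * _).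
have mh : measurable_fun setT h.
  apply: emeasurable_funM; apply/measurable_EFinP.
    by apply: measurable_indic; exact: measurable_itv.
  by apply: measurable_funM => //; exact: measurable_powR.
have h0 t : 0 <= h t.
  by apply: mule_ge0; rewrite lee_fin ?mulr_ge0 ?powR_ge0 ?exprn_ge0 ?enorm_ge0.
rewrite -(ge0_integralZr _ _ mh)//.
apply: eq_integral => t _; rewrite /h /Q /= !indicE.
have -> : ((t, z) \in C) = (t \in `[enorm z, +oo[%classic).
  by apply/idP/idP; rewrite !inE /C/= in_itv/= andbT zpos.
case: (boolP (t \in _)) => [|_]; last by rewrite !(mul0r,mul0e).
rewrite inE/= in_itv/= andbT => zt.
by rewrite !mul1r mul1e.
Qed.

End polar_coordinates.

(** * Decay and integrability *)

Section decay.
Context {R : realType} {n : nat}.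
Local Notation V := 'rV[R]_n.
Local Notation leb := (@lebesgue_measure R).
Local Notation mu := (lebesgue_rV n : {measure set V -> \bar R}).

Definition N2 (y : V) : R := \sum_i y ord0 i ^+ 2.
(** The square of the Japanese bracket, a polynomial; decay and growth are both measured by its
    powers. *)
Definition J (y : V) : R := 1 + N2 y.

Lemma N2_ge0 y : 0 <= N2 y.
Proof. by apply: sumr_ge0 => i _; exact: sqr_ge0. Qed.

Lemma J_ge1 y : 1 <= J y.
Proof. by rewrite /J lerDl N2_ge0. Qed.

Lemma J_gt0 y : 0 < J y.
Proof. exact: lt_le_trans (J_ge1 y). Qed.

Lemma le_sqr_N2 (y : V) (i : 'I_n) : y ord0 i ^+ 2 <= N2 y.
Proof.
rewrite /N2 (bigD1 i)//= lerDl; apply: sumr_ge0 => j _; exact: sqr_ge0.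
Qed.

Lemma enormE y : enorm y = Num.sqrt (N2 y).
Proof. by []. Qed.

Lemma N2D y z : N2 (y + z) <= 2 * N2 y + 2 * N2 z.
Proof.
rewrite /N2 !mulr_sumr -big_split/=; apply: ler_sum => i _; rewrite mxE.
by have := sqr_ge0 (y ord0 i - z ord0 i); nra.
Qed.

Lemma N2N y : N2 (- y) = N2 y.
Proof. by apply: eq_bigr => i _; rewrite mxE sqrrN. Qed.

(** Peetre's inequality: it lets bounds by powers of J survive translation. *)
Lemma JD y z : J (y + z) <= 2 * J y * J z.
Proof.
have := N2D y z; rewrite /J; have := N2_ge0 y; have := N2_ge0 z; nra.
Qed.

Lemma measurable_N2 : measurable_fun setT (N2 : V -> measurableTypeR R).
Proof.
apply: measurable_sum => i; apply: measurable_funX; exact: measurable_coord.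
Qed.

Lemma le_invJ_weight y : (J y ^+ n)^-1 <= weight y.
Proof.
rewrite /weight prodfV lef_pV2 ?posrE ?exprn_gt0 ?J_gt0//; last first.
  by apply: prodr_gt0 => i _; have := sqr_ge0 (y ord0 i); lra.
rewrite -[in leRHS](card_ord n) -prodr_const; apply: ler_prod => i _.
have := sqr_ge0 (y ord0 i); have := le_sqr_N2 y i; rewrite /J => *; apply/andP; split; lra.
Qed.

(* Functions of class [flat r] vanish on the ball of radius sqrt r around 0; kernels are only controlled outside it. *)
Definition rapid (v : V -> R) := forall N : nat, exists C, forall y, `|v y| * J y ^+ N <= C.
Definition flat (r : R) (v : V -> R) := forall y, N2 y < r -> v y = 0.
Definition tempered (r : R) (K : V -> R) :=
  exists C (m : nat), forall y, r <= N2 y -> `|K y| <= C * J y ^+ m.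

Lemma integrable_decay (v : V -> R) : measurable_fun setT (v : V -> measurableTypeR R) ->
  (exists C, forall y, `|v y| * J y ^+ n <= C) -> mu.-integrable setT (EFin \o v).
Proof.
move=> mv [C hC].
have C0 : 0 <= C by rewrite (le_trans _ (hC 0))// mulr_ge0// exprn_ge0// ltW// J_gt0.
apply: (@le_integrable _ _ _ mu setT measurableT _ (fun y => C%:E * (EFin \o @weight R n) y)%E).
- exact/measurable_EFinP.
- move=> y _ /=; rewrite lee_fin (ger0_norm (mulr_ge0 C0 (ltW (weight_gt0 y)))).
  apply: le_trans (ler_wpM2l C0 (le_invJ_weight y)).
  by rewrite ler_pdivlMr ?exprn_gt0 ?J_gt0.
- by apply: integrableZl => //; exact: integrable_weight.
Qed.

Lemma rapidM_tempered r v K : rapid v -> flat r v -> tempered r K ->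
  forall N : nat, exists C, forall y, `|v y * K y| * J y ^+ N <= C.
Proof.
move=> rv fv [C [m hK]] N; have [D hD] := rv (m + N)%N.
exists (`|C| * `|D|) => y; have [ry|ry] := ltP (N2 y) r.
  by rewrite fv// mul0r normr0 mul0r mulr_ge0.
have J0 := exprn_ge0 N (ltW (J_gt0 y)).
have Jm := exprn_ge0 m (ltW (J_gt0 y)).
rewrite normrM; have := hK y ry; have := hD y; rewrite exprD => h1 h2.
have h3 : `|K y| <= `|C| * J y ^+ m.
  by rewrite (le_trans h2)// ler_wpM2r// ler_norm.
have h4 : `|v y| * `|K y| * J y ^+ N <= `|v y| * (`|C| * J y ^+ m) * J y ^+ N.
  by rewrite ler_wpM2r// ler_wpM2l.
apply: (le_trans h4).
rewrite (_ : _ * _ = `|C| * (`|v y| * (J y ^+ m * J y ^+ N))); last by ring.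
by rewrite ler_wpM2l// (le_trans h1)// ler_norm.
Qed.

Lemma integrable_rapidM r v K :
  measurable_fun setT (v : V -> measurableTypeR R) ->
  measurable_fun setT (K : V -> measurableTypeR R) ->
  rapid v -> flat r v -> tempered r K ->
  mu.-integrable setT (EFin \o (fun y => v y * K y)).
Proof.
move=> mv mK rv fv tK; apply: integrable_decay; first exact: measurable_funM.
exact: (rapidM_tempered rv fv tK).
Qed.

Lemma N2_ray (xi : V) (t : R) : unit_sphere n xi -> N2 (t *: xi) = t ^+ 2.
Proof.
move=> xi1; have -> : N2 (t *: xi) = enorm (t *: xi) ^+ 2 by rewrite enorm_sqr.
by rewrite enormZ xi1 mulr1 real_normK ?num_real.
Qed.

(** On the ray J = 1 + t^2, and t^(n-1) <= (1 + t^2)^n; of the n + 1 powers of J one is left, giving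
    the majorant C / (1 + t^2). *)
Lemma integrable_ray (G : V -> R) (xi : V) :
  measurable_fun setT (G : V -> measurableTypeR R) ->
  (exists C, forall y, `|G y| * J y ^+ n.+1 <= C) -> unit_sphere n xi ->
  leb.-integrable `]0, +oo[ (fun t : R => (t ^+ n.-1 * G (t *: xi))%:E).
Proof.
move=> mG [C hC] xi1.
have C0 : 0 <= C by rewrite (le_trans _ (hC 0))// mulr_ge0// exprn_ge0// ltW// J_gt0.
have mI : measurable (`]0, +oo[%classic : set (measurableTypeR R)) by exact: measurable_itv.
have mt : measurable_fun setT (fun t : measurableTypeR R => (t ^+ n.-1 * G ((t : R) *: xi))%:E).
  apply/measurable_EFinP; apply: measurable_funM; first exact: measurable_funX.
  apply: (measurableT_comp mG).
  exact: (measurableT_comp (@measurable_scale_rV R n) (pair2_measurable xi)).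
apply: (@le_integrable _ _ _ leb _ mI _ (fun t : R => C%:E * ((1 + t ^+ 2)^-1)%:E)%E).
- exact: measurable_funTS.
- move=> t; rewrite /= in_itv/= andbT => t0.
  have p1 : 0 < 1 + t ^+ 2 by have := sqr_ge0 t; lra.
  have Jt : J (t *: xi) = 1 + t ^+ 2 by rewrite /J N2_ray.
  have q0 : 0 <= C / (1 + t ^+ 2) by rewrite divr_ge0// ltW.
  rewrite lee_fin normrM (ger0_norm (exprn_ge0 _ (ltW t0))) (ger0_norm q0) ler_pdivlMr//.
  have := hC (t *: xi); rewrite Jt exprS => h.
  apply: le_trans h.
  have tt : t <= 1 + t ^+ 2 by have := sqr_ge0 (t - 1); have := sqr_ge0 t; nra.
  have h5 : t ^+ n.-1 <= (1 + t ^+ 2) ^+ n.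
    apply: (@le_trans _ _ ((1 + t ^+ 2) ^+ n.-1)); first by rewrite lerXn2r ?nnegrE ?(ltW t0) ?(ltW p1).
    by rewrite ler_weXn2l ?leq_pred//; have := sqr_ge0 t; lra.
  rewrite (_ : t ^+ n.-1 * `|G (t *: xi)| * (1 + t ^+ 2) =
    (`|G (t *: xi)| * (1 + t ^+ 2)) * t ^+ n.-1); last by ring.
  by rewrite mulrA ler_wpM2l// mulr_ge0// ltW.
- by apply: integrableZl => //; apply: integrableS integrable_oneDsqrV.
Qed.

(** The nonnegative formula is applied to the positive and the negative part of G. By
    [integrable_ray] both ray integrals are finite at every unit vector, so they can be subtracted
    pointwise. *)
Lemma Rintegral_polar (G : V -> R) : (0 < n)%N ->
  measurable_fun setT (G : V -> measurableTypeR R) ->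
  (exists C, forall y, `|G y| * J y ^+ n.+1 <= C) ->
  Rintegral (surface_measure n) (unit_sphere n)
    (fun xi => Rintegral leb `]0, +oo[ (fun t => t ^+ n.-1 * G (t *: xi))) =
  Rintegral mu setT G.
Proof.
move=> n0 mG [C hC].
have C0 : 0 <= C by rewrite (le_trans _ (hC 0))// mulr_ge0// exprn_ge0// ltW// J_gt0.
have iG : mu.-integrable setT (EFin \o G).
  apply: integrable_decay => //; exists C => y; apply: le_trans (hC y).
  by rewrite ler_wpM2l// ler_weXn2l// J_ge1.
have mI : measurable (`]0, +oo[%classic : set (measurableTypeR R)) by exact: measurable_itv.
have mEG : measurable_fun setT (EFin \o G) by exact/measurable_EFinP.
have mGs (H : V -> \bar R) : measurable_fun setT H -> measurable_fun setT
    (fun p : measurableTypeR R * V => (p.1 ^+ n.-1)%:E * H ((p.1 : R) *: p.2))%E.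
  move=> mH; apply: emeasurable_funM.
    by apply/measurable_EFinP; exact: measurable_funX.
  by apply: measurableT_comp => //; exact: measurable_scale_rV.
pose A (H : V -> \bar R) xi :=
  (\int[leb]_(t in `]0%R, +oo[) ((t ^+ n.-1)%:E * H (t *: xi)))%E.
have mA (H : V -> \bar R) : measurable_fun setT H -> (forall y, (0 <= H y)%E) ->
    measurable_fun setT (A H).
  move=> mH H0; pose k (p : measurableTypeR R * V) :=
    ((\1_(`]0%R, +oo[%classic : set (measurableTypeR R)) p.1)%:E * ((p.1 ^+ n.-1)%:E * H ((p.1 : R) *: p.2)))%E.
  have mk : measurable_fun setT k.
    apply: emeasurable_funM; last exact: mGs.
    apply/measurable_EFinP.
    exact: (measurableT_comp (measurable_indic mI) measurable_fst).
  have k0 p : (0 <= k p)%E.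
    rewrite /k indicE; case: (boolP (_ \in _)) => [|_]; last by rewrite mul0e.
    rewrite inE/= in_itv/= andbT => /ltW p0.
    by rewrite mul1e mule_ge0// lee_fin exprn_ge0.
  rewrite (_ : A H = fun xi => \int[leb]_t k (t, xi))%E; last first.
    by apply/funext => xi; rewrite /A integral_indicM.
  exact: (measurable_fun_fubini_tonelli_G _ mk).
have iin xi := integrable_ray mG (ex_intro _ C hC) (xi := xi).
pose Gp := ((EFin \o G)^\+)%E; pose Gm := ((EFin \o G)^\-)%E.
have mGp : measurable_fun setT Gp by exact: measurable_funepos.
have mGm : measurable_fun setT Gm by exact: measurable_funeneg.
have Gp0 y : (0 <= Gp y)%E by exact: funepos_ge0.
have Gm0 y : (0 <= Gm y)%E by exact: funeneg_ge0.
have AE xi : unit_sphere n xi -> [/\ A Gp xi \is a fin_num, A Gm xi \is a fin_num &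
    (\int[leb]_(t in `]0%R, +oo[) (t ^+ n.-1 * G (t *: xi))%:E = A Gp xi - A Gm xi)%E].
  move=> xi1; have i1 := iin _ xi1.
  have := integrable_funepos mI i1; have := integrable_funeneg mI i1.
  have E1 : A Gp xi = (\int[leb]_(t in `]0%R, +oo[) (fun t : R => (t ^+ n.-1 * G (t *: xi))%:E)^\+ t)%E.
    apply: eq_integral => t; rewrite inE/= in_itv/= andbT => t0.
    by rewrite /Gp !funeposE/= EFinM maxe_pMr ?mule0// lee_fin exprn_ge0// ltW.
  have E2 : A Gm xi = (\int[leb]_(t in `]0%R, +oo[) (fun t : R => (t ^+ n.-1 * G (t *: xi))%:E)^\- t)%E.
    apply: eq_integral => t; rewrite inE/= in_itv/= andbT => t0.
    by rewrite /Gm !funenegE maxe_pMr ?mule0 ?muleN// lee_fin exprn_ge0// ltW.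
  move=> /(integrable_fin_num mI) + /(integrable_fin_num mI).
  by rewrite E1 E2 => f1 f2; split => //; rewrite [LHS]integralE.
have PE H : measurable_fun setT H -> (forall y, (0 <= H y)%E) ->
   (\int[surface_measure n]_(xi in unit_sphere n) A H xi = \int[mu]_y H y)%E.
  by move=> mH H0; exact: ge0_integral_polar.
have mS := @measurable_unit_sphere R n.
have A0 H : (forall y, (0 <= H y)%E) -> forall xi, (0 <= A H xi)%E.
  move=> H0 xi; apply: integral_ge0 => t; rewrite /= in_itv/= andbT => t0.
  by rewrite mule_ge0// lee_fin exprn_ge0// ltW.
have iA H : mu.-integrable setT H -> (forall y, (0 <= H y)%E) ->
    (surface_measure n).-integrable (unit_sphere n) (A H).
  move=> iH H0; have mH := measurable_int _ iH.
  apply/integrableP; split; first by apply: measurable_funTS; exact: mA.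
  rewrite (eq_integral (A H)); last by move=> xi _; rewrite gee0_abs// A0.
  rewrite PE// ltey_eq.
  by rewrite (integrable_fin_num measurableT iH).
congr fine.
rewrite (eq_integral (fun xi => A Gp xi - A Gm xi)%E); last first.
  by move=> xi; rewrite inE => /AE[f1 f2 e]; rewrite /Rintegral e fineK// fin_numB f1 f2.
rewrite integralB//; [|by apply: iA => //; exact: integrable_funepos|by apply: iA => //; exact: integrable_funeneg].
by rewrite !PE// [RHS]integralE.
Qed.

End decay.

(** * Null sets *)

Section continuous_measurable.
Context {R : realType} {n : nat}.
Local Notation V := 'rV[R]_n.
Local Notation leb := (@lebesgue_measure R).
Local Notation mu := (lebesgue_rV n : {measure set V -> \bar R}).

Definition cube (x : V) (e : R) : set V :=
  [set y | forall i, `]x ord0 i - e, x ord0 i + e[%classic (y ord0 i)].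

Lemma measurable_cube x e : measurable (cube x e).
Proof.
by apply: (measurable_box (A := fun i => `]x ord0 i - e, x ord0 i + e[%classic)) => i; exact: measurable_itv.
Qed.

Lemma lebesgue_cube x e : 0 < e -> mu (cube x e) = ((2 * e) ^+ n)%:E.
Proof.
move=> e0; rewrite [LHS](lebesgue_rV_box (A := fun i => `]x ord0 i - e, x ord0 i + e[%classic)); last first.
  by move=> i; exact: measurable_itv.
rewrite (eq_bigr (fun _ => (2 * e)%:E)); last first.
  move=> i _; rewrite lebesgue_measure_itv/= lte_fin ifT; last by lra.
  by rewrite -EFinD; congr EFin; ring.
elim: (n) => [|m IH]; first by rewrite big_ord0 expr0.
by rewrite big_ord_recl IH -EFinM -exprS.
Qed.

Lemma open_cube (U : set V) x : open U -> U x -> exists2 e, 0 < e & cube x e `<=` U.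
Proof.
move=> oU Ux; have /nbhs_ballP[e /= e0 eU] := open_nbhs_nbhs (conj oU Ux).
exists e => // y cy; apply: eU; split => // i j; rewrite ord1.
have := cy j; rewrite /= in_itv/= => /andP[h1 h2].
by rewrite /ball/= ltr_norml; apply/andP; split; lra.
Qed.

(** The sigma-algebra is generated by the coordinates, so an open set is exhibited as a countable
    union of cubes with rational centres and radii 1/(k+1). *)
Lemma open_measurable_rV (U : set V) : open U -> measurable U.
Proof.
move=> oU.
pose q2r (q : 'rV[rat]_n) : V := \row_i ratr (q ord0 i).
pose P (p : 'rV[rat]_n * nat) := cube (q2r p.1) (p.2.+1%:R^-1) `<=` U.
have -> : U = \bigcup_p (if `[< P p >] then cube (q2r p.1) (p.2.+1%:R^-1) else set0).
  apply/seteqP; split => [x Ux|x [p _]]; last by case: asboolP => // Pp /Pp.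
  have [e e0 eU] := open_cube oU Ux.
  have [k ke] : exists k : nat, k.+1%:R^-1 < e / 2.
    have e2 : 0 < e / 2 by lra.
    exists (Num.truncn (e / 2)^-1).
    by rewrite invf_plt ?posrE//; exact: truncnS_gt.
  have k0 : 0 < k.+1%:R^-1 :> R by rewrite invr_gt0.
  set d : R := k.+1%:R^-1 in ke k0.
  have H i : exists q : rat, x ord0 i - d < ratr q < x ord0 i + d.
    have /rat_in_itvoo[q] : x ord0 i - d < x ord0 i + d by lra.
    by rewrite in_itv/= => h; exists q.
  have [q Hq] := choice H.
  exists (\row_i q i, k) => //; rewrite asboolT.
    move=> i; rewrite /= in_itv/= !mxE -/d.
    by have /andP[h1 h2] := Hq i; apply/andP; split; lra.
  move=> y cy; apply: eU => i; have := cy i; rewrite /= !in_itv/= !mxE -/d.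
  by have /andP[h1 h2] := Hq i; move=> /andP[h3 h4]; apply/andP; split; lra.
apply: countable_bigcupT_measurable; first exact: countableP.
by move=> p; case: asboolP => // _; exact: measurable_cube.
Qed.

Lemma continuous_measurable_rV (g : V -> R) : continuous g ->
  measurable_fun setT (g : V -> measurableTypeR R).
Proof.
move=> /continuousP cg; apply: (measurability _ (RGenOpens.measurableE R)).
move=> _ [_ [a [b ->] <-]]; rewrite setTI; apply: open_measurable_rV.
exact/cg/interval_open.
Qed.

Local Notation ei i := (delta_mx ord0 i : V).

(* The translates of a bounded part of [Z] by [r / L * e_i], r <= m, with L = (k + 1) * (m + 1)!, are pairwise
   disjoint, because the difference of two such shifts is [1 / (j + 1)] with j >= k. *)
Lemma isolated_zeros_null (F : V -> R) (i : 'I_n) (k : nat) :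
  measurable_fun setT (F : V -> measurableTypeR R) ->
  let Z := [set x | F x = 0 /\ forall j, (k <= j)%N -> F (x + j.+1%:R^-1 *: ei i) != 0] in
  measurable Z /\ mu Z = 0%E.
Proof.
move=> mF Z.
have mz : measurable [set x | F x = 0].
  rewrite -[X in measurable X]setTI.
  exact: (mF measurableT _ (measurable_set1 (0 : R))).
have mt (v : V) : measurable_fun setT (fun y : V => y + v).
  by rewrite (_ : (fun _ => _) = (fun y => 1 *: y + v)); [exact: measurable_affine|apply/funext => y; rewrite scale1r].
have mZ : measurable Z.
  rewrite (_ : Z = [set x | F x = 0] `&` \bigcap_(j in [set j | (k <= j)%N])
     ~` ((fun y => y + j.+1%:R^-1 *: ei i) @^-1` [set x | F x = 0])).
    apply: measurableI => //; apply: bigcap_measurable; first by exists k => /=.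
    move=> j _; apply: measurableC; rewrite -[X in measurable X]setTI; exact: mt.
  apply/seteqP; split => x /= [h1 h2]; split=> // j kj; first exact/eqP/h2.
  exact/eqP/h2.
split=> //.
have HM (M : nat) : mu (Z `&` cube 0 M.+1%:R) = 0%E.
  set A := Z `&` cube 0 M.+1%:R.
  have mA : measurable A by apply: measurableI => //; exact: measurable_cube.
  have H (m : nat) : (m.+1%:R%:E * mu A <= ((2 * M.+2%:R) ^+ n)%:E)%E.
    pose L : R := k.+1%:R * (m.+1)`!%:R.
    have L0 : 0 < L by rewrite mulr_gt0 ?ltr0n ?fact_gt0.
    pose T (r : nat) := (fun y : V => y + (- (r%:R / L) *: ei i)) @^-1` A.
    have mT r : measurable (T r) by rewrite -[X in measurable X]setTI; exact: mt.
    have muT r : mu (T r) = mu A by exact: lebesgue_rV_translate.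
    have dT r r' : (r < r' < m.+1)%N -> T r `&` T r' = set0.
      move=> /andP[rr' rm]; rewrite -subset0 => y [[[Z1 _] _] [[Z2 Z3] _]].
      pose d := (r' - r)%N.
      have d0 : (0 < d)%N by rewrite subn_gt0.
      have ddvd : (d %| m.+1`!)%N by apply: dvdn_fact; rewrite d0/= (leq_trans (leq_subr _ _))// ltnW.
      (* The two shifts differ by d / L = 1 / q with q >= k + 1, so the condition in [Z] at index q
         - 1 is contradicted. *)
      pose q := (k.+1 * (m.+1`! %/ d))%N.
      have q0 : (0 < m.+1`! %/ d)%N by rewrite divn_gt0// dvdn_leq// fact_gt0.
      have kq : (k.+1 <= q)%N by rewrite leq_pmulr.
      have qp : (0 < q)%N by exact: leq_trans kq.
      have := Z3 q.-1; rewrite -ltnS (prednK qp) => /(_ kq) /eqP; apply.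
      rewrite -[RHS]Z1; congr F; rewrite -addrA -scalerDl; congr (_ + _ *: _).
      have -> : q%:R = L / d%:R :> R.
        rewrite /q natrM /L -mulrA; congr (_ * _).
        have -> : (m.+1)`!%:R = ((m.+1`! %/ d) * d)%N%:R :> R by rewrite divnK.
        by rewrite natrM mulfK// pnatr_eq0 -lt0n.
      rewrite invf_div /d natrB ?(ltnW rr')//.
      by field; rewrite gt_eqF.
    have cT r : (r < m.+1)%N -> T r `<=` cube 0 M.+2%:R.
      move=> rm y [_ cy] j; have := cy j; rewrite /= !in_itv/= !mxE/= !sub0r !add0r.
      have rL0 : 0 <= r%:R / L by rewrite divr_ge0// ltW.
      have rL : r%:R / L <= 1.
        rewrite ler_pdivrMr// mul1r /L -natrM ler_nat.
        rewrite (leq_trans (ltnW rm))// (leq_trans (fact_geq _))//.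
        by rewrite leq_pmull.
      rewrite -[M.+2%:R]natr1.
      by case: (j == i) => /=; rewrite ?mulr1n ?mulr0n ?mulr1 ?mulr0 => /andP[h1 h2]; apply/andP; split; lra.
    rewrite -(lebesgue_cube (0 : V))//.
    apply: (@le_trans _ _ (mu (\big[setU/set0]_(r < m.+1) T r))); last first.
      apply: le_measure; rewrite ?inE.
      - by apply: bigsetU_measurable => r _; exact: mT.
      - exact: measurable_cube.
      - by rewrite -bigcup_mkord => y [r /= rm]; exact: cT.
    rewrite measure_semi_additive_ord_I//.
    - rewrite (eq_bigr (fun _ => mu A)); last by move=> r _; exact: muT.
      suff -> k' : (\sum_(r < k') mu A = k'%:R%:E * mu A)%E by [].
      elim: k' => [|k' IH]; first by rewrite big_ord0 mul0e.
      by rewrite big_ord_recl IH -nat1r EFinD ge0_muleDl ?lee_fin// mul1e.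
    - move=> r r' rm rm' /set0P/eqP ne; apply/eqP; apply: contrapT => rr'; apply: ne.
      have [lt|lt|E] := ltngtP r r'.
      + by apply: dT; rewrite lt.
      + by rewrite setIC; apply: dT; rewrite lt.
      + by exfalso; apply: rr'; rewrite E.
    - by apply: bigsetU_measurable => r _; exact: mT.
  have fA : mu A \is a fin_num.
    rewrite ge0_fin_numE//; apply: le_lt_trans (ltry ((2 * M.+2%:R) ^+ n)).
    by have := H 0%N; rewrite mul1e.
  move: (measure_ge0 mu A) H; rewrite -(fineK fA); set a := fine _ => a0 H.
  congr EFin; apply: contrapT => /eqP aN0.
  have ap : 0 < a by rewrite lt_def aN0/=; exact: fine_ge0.
  (* With m + 1 above (2 (M + 2))^n / a, the m + 1 disjoint translates would exceed the volume of
     the cube that contains them. *)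
  have := H (Num.truncn ((2 * M.+2%:R) ^+ n / a)).
  by rewrite -EFinM lee_fin leNgt -ltr_pdivrMr ?truncnS_gt.
have EZ : Z = \bigcup_M (Z `&` cube 0 M.+1%:R).
  rewrite -setI_bigcupr; apply/esym/setIidPl => x _.
  exists (Num.truncn (J x)) => // j; rewrite /= in_itv/= mxE sub0r add0r.
  have h : J x < (Num.truncn (J x)).+1%:R by exact: truncnS_gt.
  set T := _.+1%:R in h *.
  have := le_sqr_N2 x j; rewrite /J in h.
  have := sqr_ge0 (x ord0 j - 1); have := sqr_ge0 (x ord0 j + 1).
  by move=> *; apply/andP; split; nra.
apply/negligibleP => //; rewrite EZ; apply: negligible_bigcup => M.
apply/negligibleP.
  by apply: measurableI => //; exact: measurable_cube.
exact: HM.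
Qed.

End continuous_measurable.

(** * Partial derivatives under the integral sign *)

Section partial_derivatives.
Context {R : realType} {n : nat}.
Local Notation V := 'rV[R]_n.
Local Notation mu := (lebesgue_rV n : {measure set V -> \bar R}).
Local Notation ei i := (delta_mx ord0 i : V).
Implicit Types (v w K : V -> R) (i : 'I_n).

(** A relation between a function and its derivative, stated on the coordinate line through y, so
    that the one-variable rules and the mean value theorem apply directly. *)
Definition pder i v v' := forall y : V,
  is_derive (0 : R) (1 : R) (fun t : R => v (y + t *: ei i)) (v' y).

Lemma is_derive_line (f g : R -> R) (x z d : R) :
  (forall h, f (h + x) = g (h + z)) -> is_derive x (1 : R) f d -> is_derive z (1 : R) g d.
Proof.
move=> fg [df <-]; have f0 : f x = g z by have := fg 0; rewrite !add0r.
have E : (fun h : R => h^-1 *: ((f \o shift x) (h *: (1 : R)) - f x)) =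
   (fun h : R => h^-1 *: ((g \o shift z) (h *: (1 : R)) - g z)).
  by apply/funext => h /=; rewrite fg f0.
by split; rewrite /derivable /derive -E.
Qed.

Lemma pder_line i v v' : pder i v v' -> forall (y : V) (t : R),
  is_derive t (1 : R) (fun s : R => v (y + s *: ei i)) (v' (y + t *: ei i)).
Proof.
move=> pv y t; apply: is_derive_line (pv (y + t *: ei i)) => h.
by rewrite addr0 scalerDl addrA addrAC.
Qed.

Lemma derivable_pder i v : (forall x, derivable v x (ei i)) ->
  pder i v (fun x => 'D_(ei i) v x).
Proof.
move=> dv y; have E : (fun h : R => h^-1 *: ((v \o shift y) (h *: ei i) - v y)) =
   (fun h : R => h^-1 *: (((fun t : R => v (y + t *: ei i)) \o shift 0) (h *: (1 : R)) - v (y + 0 *: ei i))).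
  apply/funext => h /=; have -> : h *: (1 : R) = h by rewrite /GRing.scale/= mulr1.
  by rewrite addr0 scale0r addr0 [h *: ei i + y]addrC.
by split; rewrite /derivable /derive -E//; exact: dv.
Qed.

Lemma pder_mvt i v v' y (h : R) : pder i v v' -> 0 < h ->
  exists2 c, 0 < c < h & v (y + h *: ei i) - v y = v' (y + c *: ei i) * h.
Proof.
move=> pv h0; have dl := pder_line pv y.
have [|c] := @MVT _ (fun s : R => v (y + s *: ei i)) (fun s => v' (y + s *: ei i)) 0 h h0 (fun x _ => dl x).
  by apply: derivable_within_continuous => x _; have [] := dl x.
by rewrite in_itv/= scale0r addr0 subr0 => ch E; exists c.
Qed.

Lemma N2_ei i (t : R) : N2 (t *: ei i) = t ^+ 2.
Proof.
rewrite /N2 (bigD1 i)//= big1 => [|j ji]; rewrite !mxE eqxx/=.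
  by rewrite eqxx mulr1 addr0.
by rewrite (negbTE ji) mulr0 expr0n.
Qed.

Lemma measurable_shift (x : V) v : measurable_fun setT (v : V -> measurableTypeR R) ->
  measurable_fun setT ((fun y => v (x + y)) : V -> measurableTypeR R).
Proof.
move=> mv; apply: (measurableT_comp mv).
have -> : +%R x = (fun y : V => 1 *: y + x).
  by apply/funext => y; rewrite scale1r addrC.
exact: measurable_affine.
Qed.

Lemma measurable_shiftr (x : V) v : measurable_fun setT (v : V -> measurableTypeR R) ->
  measurable_fun setT ((fun y => v (y + x)) : V -> measurableTypeR R).
Proof.
by move=> /(measurable_shift x); under eq_fun do rewrite addrC.
Qed.

(** Dominated convergence. If N2 y < r/4, then h^2 <= r/4 keeps y + h e_i in the region where v
    vanishes, so K matters only where it is bounded. Elsewhere the quotient is v' at a point z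
    between y and y + h e_i; as h <= 1, J y <= 4 J z, and the decay of v' at z beats the growth of K
    at y. *)
Lemma cvg_difference_quotient i v v' K (r : R) (h : nat -> R) :
  measurable_fun setT (v : V -> measurableTypeR R) ->
  measurable_fun setT (v' : V -> measurableTypeR R) ->
  measurable_fun setT (K : V -> measurableTypeR R) ->
  pder i v v' -> rapid v' -> flat r v -> tempered (r / 4) K ->
  (forall k, [/\ 0 < h k, h k <= 1 & h k ^+ 2 <= r / 4]) -> h @ \oo --> (0 : R) ->
  Rintegral mu setT (fun y => (v (y + h k *: ei i) - v y) / h k * K y) @[k --> \oo] -->
  Rintegral mu setT (fun y => v' y * K y).
Proof.
move=> mv mv' mK pv rv' fv [C [m tK]] hk h0.
have [D hD] := rv' (m + n)%N.
have D0 : 0 <= D by rewrite (le_trans _ (hD 0))// mulr_ge0// exprn_ge0// ltW// J_gt0.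
pose q k y := (v (y + h k *: ei i) - v y) / h k * K y.
pose B := `|C| * D * 4 ^+ (m + n).
have B0 : 0 <= B by rewrite !mulr_ge0// exprn_ge0.
have qB k y : `|q k y| <= B * weight y.
  have [hk0 hk1 hkr] := hk k.
  have [yr|yr] := ltP (N2 y) (r / 4).
    rewrite /q !fv.
    - by rewrite subr0 mul0r mul0r normr0 mulr_ge0// ltW// weight_gt0.
    - by rewrite (lt_le_trans yr)//; have := sqr_ge0 (h k); lra.
    - have := N2D y (h k *: ei i); rewrite N2_ei; lra.
  have [c /andP[c0 ch] E] := pder_mvt y pv hk0.
  rewrite /q E mulfK ?gt_eqF// normrM.
  apply: le_trans (ler_wpM2l B0 (le_invJ_weight y)).
  rewrite ler_pdivlMr ?exprn_gt0 ?J_gt0//.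
  set z := y + c *: ei i.
  have Jz0 := J_gt0 z; have Jy0 := J_gt0 y.
  have Jyz : J y <= 4 * J z.
    have := JD z (- (c *: ei i)); rewrite /z addrK => /le_trans; apply.
    have -> : J (- (c *: ei i)) = 1 + c ^+ 2 by rewrite /J N2N N2_ei.
    have c2 : c ^+ 2 <= 1 by rewrite expr_le1// ?ltW// (lt_le_trans ch).
    nra.
  have h1 : `|K y| <= `|C| * J y ^+ m.
    by rewrite (le_trans (tK y yr))// ler_wpM2r ?ler_norm// exprn_ge0// ltW.
  have h2 : J y ^+ (m + n) <= 4 ^+ (m + n) * J z ^+ (m + n).
    by rewrite -exprMn lerXn2r ?nnegrE ?mulr_ge0// ltW.
  apply: (@le_trans _ _ (`|v' z| * (`|C| * J y ^+ m) * J y ^+ n)).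
    by rewrite ler_wpM2r ?exprn_ge0 ?(ltW Jy0)// ler_wpM2l.
  rewrite (_ : _ * _ = `|C| * `|v' z| * J y ^+ (m + n)); last by rewrite exprD; ring.
  apply: (@le_trans _ _ (`|C| * `|v' z| * (4 ^+ (m + n) * J z ^+ (m + n)))).
    by rewrite ler_wpM2l// mulr_ge0.
  rewrite (_ : _ * _ = `|C| * (`|v' z| * J z ^+ (m + n)) * 4 ^+ (m + n)); last by ring.
  by rewrite /B ler_wpM2r ?exprn_ge0// ler_wpM2l.
have mq k : measurable_fun setT (EFin \o q k).
  apply/measurable_EFinP; apply: measurable_funM => //; apply: measurable_funM => //.
  apply: measurable_funB => //; exact: measurable_shiftr.
have mf : measurable_fun setT (EFin \o (fun y => v' y * K y)).
  by apply/measurable_EFinP; exact: measurable_funM.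
have iB : mu.-integrable setT (fun y => B%:E * (weight y)%:E)%E.
  by apply: integrableZl => //; exact: integrable_weight.
have qcvg y : q k y @[k --> \oo] --> v' y * K y.
  apply: cvgM; last exact: cvg_cst.
  have hc : h @ \oo --> (0 : R)^'.
    move=> A A0; have H : \forall k \near \oo, h k != 0 -> A (h k) := h0 _ A0.
    rewrite /nbhs/=; apply: filterS H => k Ak; apply: Ak.
    by have [hk0 _ _] := hk k; rewrite gt_eqF.
  have dc : (fun t : R => t^-1 *: (((fun t : R => v (y + t *: ei i)) \o shift 0) (t *: (1 : R)) - v (y + 0 *: ei i))) @ (0 : R)^' --> v' y.
    by have [dv <-] := pv y; exact: dv.
  have := cvg_comp _ _ hc dc; apply: cvg_trans; apply: near_eq_cvg.
  apply: nearW => k /=; have -> : h k *: (1 : R) = h k by rewrite /GRing.scale/= mulr1.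
  by rewrite addr0 scale0r addr0 mulrC.
have c1 : {ae mu, forall y, setT y -> (EFin \o q k) y @[k --> \oo] --> (EFin \o (fun y => v' y * K y)) y}.
  by apply: aeW => y _; apply: cvg_EFin; [exact: nearW|exact: qcvg].
have c2 : {ae mu, forall y k, setT y -> `|(EFin \o q k) y| <= B%:E * (weight y)%:E}%E.
  by apply: aeW => y k _; rewrite /= lee_fin; exact: qB.
have [iK _ cI] := @dominated_convergence _ _ _ mu setT measurableT (fun k => EFin \o q k)
  (EFin \o (fun y => v' y * K y)) (fun y => B%:E * (weight y)%:E)%E mq mf c1 iB c2.
apply: fine_cvg; rewrite fineK; first exact: cI.
exact: (integrable_fin_num measurableT iK).
Qed.

(* By translation invariance the difference quotients of [v] have integral 0. *)
Lemma integral_pder_eq0 i v v' (r : R) : 0 < r ->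
  measurable_fun setT (v : V -> measurableTypeR R) ->
  measurable_fun setT (v' : V -> measurableTypeR R) ->
  pder i v v' -> rapid v -> rapid v' -> flat r v ->
  Rintegral mu setT v' = 0.
Proof.
move=> r0 mv mv' pv rv rv' fv.
(* For 0 < h <= e both h <= 1 and h^2 <= e <= r/4 hold. *)
pose e := Num.min 1 (r / 4).
have e0 : 0 < e by rewrite lt_min ltr01 divr_gt0.
have e1 : e <= 1 by rewrite ge_min lexx.
have er : e <= r / 4 by rewrite ge_min lexx orbT.
pose h (k : nat) := e * k.+1%:R^-1.
have h1 k : k.+1%:R^-1 <= 1 :> R by rewrite invf_le1// ler1n.
have h0 k : 0 < k.+1%:R^-1 :> R by rewrite invr_gt0.
have hk k : [/\ 0 < h k, h k <= 1 & h k ^+ 2 <= r / 4].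
  rewrite /h; set d := k.+1%:R^-1; have := h1 k; have := h0 k; rewrite -/d => d0 d1.
  have p0 : 0 < e * d by rewrite mulr_gt0.
  have p1 : e * d <= e by rewrite ler_piMr// ltW.
  by split => //; nra.
have hc : h @ \oo --> (0 : R).
  rewrite -(mulr0 e); apply: cvgM; [exact: cvg_cst|exact: cvg_harmonic].
have t1 : tempered (r / 4) (cst (1 : R) : V -> R).
  by exists 1, 0%N => y _; rewrite normr1 expr0 mulr1.
have iv : mu.-integrable setT (EFin \o v).
  by apply: integrable_decay => //; exact: rv.
have := cvg_difference_quotient mv mv' (measurable_cst (1 : measurableTypeR R)) pv rv' fv t1 hk hc.
have -> : (fun k => Rintegral mu setT (fun y => (v (y + h k *: ei i) - v y) / h k * 1)) = (fun=> 0).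
  apply/funext => k.
  have ivh : mu.-integrable setT (EFin \o (fun y => v (y + h k *: ei i))).
    apply/integrableP; split; first by apply/measurable_EFinP; exact: measurable_shiftr.
    rewrite (@integral_translate _ _ _ (fun y => `|(EFin \o v) y|%E)).
      by have /integrableP[] := iv.
    by apply: measurableT_comp => //; exact/measurable_EFinP.
  under eq_Rintegral do rewrite mulr1.
  rewrite RintegralZr//; last exact: (integrableB measurableT ivh iv).
  rewrite RintegralB// /Rintegral (@integral_translate _ _ _ (EFin \o v)); last exact/measurable_EFinP.
  by rewrite subrr mul0r.
under [in X in _ --> X]eq_Rintegral do rewrite mulr1.
move=> H; have := cvg_cst (0 : R) => /(_ nat \oo _) H0.
by apply/esym; apply: (cvg_unique _ H0 H).
Qed.

(** [integral_pder_eq0] is applied to v K. The kernel is differentiable only off the origin; at the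
    origin the product is locally 0 along the coordinate line, since v vanishes near 0. *)
Lemma integration_by_parts_pder i v v' K K' (r : R) : 0 < r ->
  measurable_fun setT (v : V -> measurableTypeR R) ->
  measurable_fun setT (v' : V -> measurableTypeR R) ->
  measurable_fun setT (K : V -> measurableTypeR R) ->
  measurable_fun setT (K' : V -> measurableTypeR R) ->
  pder i v v' -> rapid v -> rapid v' -> flat r v -> flat r v' ->
  tempered r K -> tempered r K' ->
  (forall y, 0 < N2 y -> is_derive (0 : R) (1 : R) (fun t : R => K (y + t *: ei i)) (K' y)) ->
  Rintegral mu setT (fun y => v' y * K y) = - Rintegral mu setT (fun y => v y * K' y).
Proof.
move=> r0 mv mv' mK mK' pv rv rv' fv fv' tK tK' dK.
have i1 := integrable_rapidM mv' mK rv' fv' tK.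
have i2 := integrable_rapidM mv mK' rv fv tK'.
apply/eqP; rewrite -subr_eq0 opprK -RintegralD//; apply/eqP.
apply: (@integral_pder_eq0 i (fun y => v y * K y) _ r) => //.
- exact: measurable_funM.
- by apply: measurable_funD; exact: measurable_funM.
- move=> y; have [y0|y0] := ltP 0 (N2 y).
    have H := @is_deriveM _ _ _ _ _ _ _ _ (pv y) (dK y y0).
    apply: (is_derive_eq H); rewrite scale0r addr0.
    by rewrite addrC; congr (_ + _); rewrite mulrC.
  have {}y0 : N2 y = 0 by apply/eqP; rewrite eq_le y0 N2_ge0.
  rewrite fv' ?y0// fv ?y0// !mul0r addr0.
  have -> : y = 0.
    by apply/eqP; rewrite -enorm_eq0 enormE y0 sqrtr0.
  apply: (@near_eq_is_derive _ _ _ (cst (0 : R))).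
  exists (Num.min 1 r); first by rewrite /= lt_min ltr01.
  move=> t /=; rewrite sub0r normrN lt_min => /andP[t1 tr].
  rewrite add0r fv ?mul0r// N2_ei.
  rewrite -real_normK ?num_real//; have := normr_ge0 t; nra.
- exact: rapidM_tempered rv fv tK.
- move=> N; have [C1 h1] := rapidM_tempered rv' fv' tK N.
  have [C2 h2] := rapidM_tempered rv fv tK' N.
  exists (C1 + C2) => y; apply: le_trans (lerD (h1 y) (h2 y)).
  by rewrite -mulrDl ler_wpM2r ?ler_normD// exprn_ge0// ltW// J_gt0.
- by move=> y yr; rewrite fv ?mul0r.
Qed.

End partial_derivatives.

(** * Almost every zero of F is a zero of all its derivatives *)

Section common_zero.
Context {R : realType} {n : nat}.
Local Notation V := 'rV[R]_n.
Local Notation mu := (lebesgue_rV n : {measure set V -> \bar R}).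
Local Notation ei i := (delta_mx ord0 i : V).
Implicit Types (v w K : V -> R) (i : 'I_n).

Lemma pder_shift i v v' (x : V) : pder i v v' -> pder i (fun y => v (x + y)) (fun y => v' (x + y)).
Proof.
move=> pv y; have := pv (x + y).
by under eq_fun do rewrite -addrA.
Qed.

Lemma rapid_shift v (x : V) : rapid v -> rapid (fun y => v (x + y)).
Proof.
move=> rv N; have [C hC] := rv N; exists (`|C| * (2 * J (- x)) ^+ N) => y.
have Jy : J y <= 2 * J (- x) * J (x + y).
  by have := JD (- x) (x + y); rewrite addKr.
have J0 := J_gt0 (- x); have J1 := J_gt0 y; have J2 := J_gt0 (x + y).
have c0 : 0 <= 2 * J (- x) by lra.
apply: (@le_trans _ _ (`|v (x + y)| * ((2 * J (- x)) ^+ N * J (x + y) ^+ N))).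
  by rewrite ler_wpM2l// -exprMn lerXn2r ?nnegrE ?(ltW J1) ?(mulr_ge0 c0 (ltW J2)).
rewrite mulrCA mulrC ler_wpM2r ?exprn_ge0//.
by rewrite (le_trans (hC _))// ler_norm.
Qed.

(** The radius is chosen before v: it depends only on U and x, so one r serves all derivatives at
    once. *)
Lemma flat_shift (U : set V) x : open U -> U x ->
  exists2 r, 0 < r & forall v, (forall y, U y -> v y = 0) -> flat r (fun y => v (x + y)).
Proof.
move=> oU Ux; have [e e0 eU] := open_cube oU Ux.
exists (e ^+ 2); first by rewrite exprn_gt0.
move=> v vU y yr; apply: vU; apply: eU => i; rewrite /= in_itv/= mxE.
have := le_sqr_N2 y i => yi.
have : (y ord0 i) ^+ 2 < e ^+ 2 by exact: le_lt_trans yr.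
rewrite -[y ord0 i ^+ 2]real_normK ?num_real// ltr_pXn2r ?nnegrE ?(ltW e0)//.
by rewrite ltr_norml => /andP[h1 h2]; apply/andP; split; lra.
Qed.

Lemma flat_pder (U : set V) i v v' : open U -> (forall y, U y -> v y = 0) ->
  pder i v v' -> forall y, U y -> v' y = 0.
Proof.
move=> oU vU pv y Uy; have [r r0 /(_ v vU) fr] := flat_shift oU Uy.
have [_ <-] := pv y.
rewrite (@near_eq_derive _ _ _ _ (cst (0 : R))) ?derive_cst//.
exists (Num.min 1 r); first by rewrite /= lt_min ltr01.
move=> t /=; rewrite sub0r normrN lt_min => /andP[t1 tr].
rewrite fr// N2_ei -real_normK ?num_real//; have := normr_ge0 t; nra.
Qed.

Lemma vanishing_pders (D : seq 'I_n -> V -> R) (U : set V) : open U ->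
  (forall i b, pder i (D b) (D (i :: b))) -> (forall x, U x -> D [::] x = 0) ->
  forall b x, U x -> D b x = 0.
Proof.
move=> oU pD DU; elim=> [|i b IH] x Ux; first exact: DU.
exact: (flat_pder oU IH (pD i b)).
Qed.

(** Valid on the whole space, also where the integral diverges: [Rintegral] is [fine] of a
    difference of two integrals of nonnegative functions, each measurable in x by Tonelli. *)
Lemma measurable_convol v K :
  measurable_fun setT (v : V -> measurableTypeR R) ->
  measurable_fun setT (K : V -> measurableTypeR R) ->
  measurable_fun setT ((fun x => Rintegral mu setT (fun y => v (x + y) * K y)) : V -> measurableTypeR R).
Proof.
move=> mv mK.
pose g (p : V * V) : \bar R := (v (p.1 + p.2) * K p.2)%:E.
have mg : measurable_fun setT g.
  apply/measurable_EFinP; apply: measurable_funM; last exact: (measurableT_comp mK measurable_snd).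
  apply: (measurableT_comp mv); apply: measurable_fun_rV => i.
  under eq_fun do rewrite mxE.
  apply: measurable_funD; first exact: (measurableT_comp (measurable_coord i) measurable_fst).
  exact: (measurableT_comp (measurable_coord i) measurable_snd).
rewrite (_ : (fun _ => _) = fine \o (fun x => \int[mu]_y (g^\+%E (x, y)) - \int[mu]_y (g^\-%E (x, y)))%E); last first.
  apply/funext => x; rewrite /Rintegral/= integralE; congr (fine (_ - _)).
    by apply: eq_integral => y _; rewrite !funeposE.
  by apply: eq_integral => y _; rewrite !funenegE.
apply: measurableT_comp => //; apply: emeasurable_funB.
  apply: (@measurable_fun_fubini_tonelli_F _ _ _ _ _ (lebesgue_rV n) g^\+%E); first exact: measurable_funepos.
  by move=> p; exact: funepos_ge0.
apply: (@measurable_fun_fubini_tonelli_F _ _ _ _ _ (lebesgue_rV n) g^\-%E); first exact: measurable_funeneg.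
by move=> p; exact: funeneg_ge0.
Qed.

(* If all F_b = 0 up to some order at x but a next derivative does not vanish at x, then x is an isolated zero of F_b
   along the points x + e_i / (j + 1): such x form a null set. *)
Lemma common_zero (D : seq 'I_n -> V -> R) K (U E : set V) :
  (forall b, measurable_fun setT (D b : V -> measurableTypeR R)) ->
  (forall i b, pder i (D b) (D (i :: b))) -> (forall b, rapid (D b)) ->
  measurable_fun setT (K : V -> measurableTypeR R) -> (forall r, 0 < r -> tempered r K) ->
  open U -> (forall x, U x -> D [::] x = 0) -> E `<=` U -> (0 < lebesgue_outer E)%E ->
  (forall x, E x -> Rintegral mu setT (fun y => D [::] (x + y) * K y) = 0) ->
  exists2 x, E x & forall b, Rintegral mu setT (fun y => D b (x + y) * K y) = 0.
Proof.
move=> mD pD rD mK tK oU DU EU E0 FE.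
have DbU := vanishing_pders oU pD DU.
pose F b x := Rintegral mu setT (fun y => D b (x + y) * K y).
have mF b : measurable_fun setT (F b : V -> measurableTypeR R) by exact: measurable_convol.
pose Z (p : seq 'I_n * 'I_n * nat) := [set x | F p.1.1 x = 0 /\
  forall j, (p.2 <= j)%N -> F p.1.1 (x + j.+1%:R^-1 *: ei p.1.2) != 0].
have Z0 p : measurable (Z p) /\ mu (Z p) = 0%E by exact: isolated_zeros_null.
(* The triples (b, i, k) form a countable type, so the exceptional sets can be enumerated. *)
pose N m := if unpickle m is Some p then Z p else set0.
have mN m : measurable (N m) by rewrite /N; case: unpickle => // p; have [] := Z0 p.
have N0 : mu (\bigcup_m N m) = 0%E.
  apply/negligibleP; first exact: bigcupT_measurable.
  apply: negligible_bigcup => m; apply/negligibleP => //.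
  by rewrite /N; case: unpickle => // p; have [] := Z0 p.
(* Were E contained in the null set, monotonicity would make its outer measure 0. *)
have [x Ex xN] : exists2 x, E x & ~ (\bigcup_m N m) x.
  apply: contrapT => H; move: E0; apply/negP; rewrite -leNgt -N0.
  rewrite -measurable_mu_extE; last exact: bigcupT_measurable.
  apply: le_mu_ext => x Ex; apply: contrapT => xN; apply: H; by exists x.
exists x => // b; elim: b => [|i b IH]; first exact: FE.
have Ux := EU _ Ex.
have [r r0 /(_ _ (DbU b)) fr] := flat_shift oU Ux.
apply: contrapT => /eqP F'0.
pose e := Num.min 1 (r / 4).
have ep : 0 < e by rewrite lt_min ltr01 divr_gt0.
pose k0 := Num.truncn e^-1.
pose h (k : nat) : R := (k + k0).+1%:R^-1.
have h0 k : 0 < h k by rewrite invr_gt0.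
have hle k : h k <= e.
  rewrite /h invf_ple ?posrE//; apply: ltW; apply: lt_le_trans (truncnS_gt _) _.
  by rewrite ler_nat ltnS leq_addl.
have hk k : [/\ 0 < h k, h k <= 1 & h k ^+ 2 <= r / 4].
  have := hle k; have := h0 k; rewrite /e le_min => p /andP[h1 h2].
  by split => //; nra.
have hc : h @ \oo --> (0 : R).
  by have := @cvg_harmonic R; rewrite -(cvg_shiftn k0); apply: cvg_trans.
have tK4 : tempered (r / 4) K by apply: tK; lra.
have := cvg_difference_quotient (measurable_shift x (mD b)) (measurable_shift x (mD (i :: b))) mK
  (pder_shift x (pD i b)) (rapid_shift x (rD (i :: b))) fr tK4 hk hc.
have iF : mu.-integrable setT (EFin \o (fun y => D b (x + y) * K y)).
  apply: (integrable_rapidM (r := r / 4)) => //; [exact: measurable_shift|exact: rapid_shift|].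
  by move=> y yr; apply: fr; lra.
have -> : (fun k => Rintegral mu setT (fun y => (D b (x + (y + h k *: ei i)) - D b (x + y)) / h k * K y)) =
    (fun k => F b (x + h k *: ei i) / h k).
  apply/funext => k; have [h1 h2 h3] := hk k.
  have iFh : mu.-integrable setT (EFin \o (fun y => D b (x + h k *: ei i + y) * K y)).
    apply: (integrable_rapidM (r := r / 4)) => //; [exact: measurable_shift|exact: rapid_shift|].
    move=> y yr; rewrite -addrA fr//.
    by have := N2D (h k *: ei i) y; rewrite N2_ei; lra.
  transitivity (Rintegral mu setT (fun y => (D b (x + h k *: ei i + y) * K y - D b (x + y) * K y) * (h k)^-1)).
    apply: eq_Rintegral => y _; rewrite [y + _]addrC addrA; ring.
  rewrite RintegralZr//; last exact: (integrableB measurableT iFh iF).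
  by rewrite RintegralB// IH subr0.
(* The quotients F_b (x + h e_i) / h tend to a nonzero limit, so they are nonzero from some M on;
   this puts x into the exceptional set of index (b, i, M + k0). *)
move=> /cvgr_neq0 /(_ F'0) [M _ HM].
apply: xN; exists (pickle (b, i, (M + k0)%N)) => //; rewrite /N pickleK; split => //= j Mj.
have Mk : (M <= j - k0)%N by rewrite leq_subRL ?(leq_trans _ Mj) ?leq_addl// addnC.
have := HM (j - k0)%N Mk; rewrite /h subnK ?(leq_trans _ Mj) ?leq_addl//.
by apply: contraNN => /eqP ->; rewrite mul0r.
Qed.

End common_zero.

(** * Kernels and the inversion y / |y|^2 *)

Section kernels.
Context {R : realType} {n : nat}.
Local Notation V := 'rV[R]_n.
Local Notation mu := (lebesgue_rV n : {measure set V -> \bar R}).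
Local Notation ei i := (delta_mx ord0 i : V).
Implicit Types (v w K : V -> R) (i : 'I_n) (l : seq 'I_n).

(** The growth bound may depend on the excluded ball, so singularities at the origin are allowed. *)
Definition admissible K := measurable_fun setT (K : V -> measurableTypeR R) /\
  forall r, 0 < r -> tempered r K.

Lemma admissible_cst (c : R) : admissible (fun=> c).
Proof.
split; first exact: measurable_cst.
by move=> r _; exists `|c|, 0%N => y _; rewrite expr0 mulr1.
Qed.

Lemma admissibleM K L : admissible K -> admissible L -> admissible (fun y => K y * L y).
Proof.
move=> [mK tK] [mL tL]; split; first exact: measurable_funM.
move=> r r0; have [C [m hK]] := tK r r0; have [D [p hL]] := tL r r0.
exists (C * D), (m + p)%N => y yr; rewrite normrM exprD mulrACA.
by apply: ler_pM => //; [exact: hK|exact: hL].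
Qed.

Lemma admissibleD K L : admissible K -> admissible L -> admissible (fun y => K y + L y).
Proof.
move=> [mK tK] [mL tL]; split; first exact: measurable_funD.
move=> r r0; have [C [m hK]] := tK r r0; have [D [p hL]] := tL r r0.
exists (`|C| + `|D|), (m + p)%N => y yr; rewrite (le_trans (ler_normD _ _))// mulrDl.
have J1 := J_ge1 y.
have mono (B : R) (a : nat) : (a <= m + p)%N -> B * J y ^+ a <= `|B| * J y ^+ (m + p).
  move=> ap; apply: (@le_trans _ _ (`|B| * J y ^+ a)).
    by rewrite ler_wpM2r ?ler_norm// exprn_ge0// (le_trans _ J1).
  by rewrite ler_wpM2l// ler_weXn2l.
apply: lerD.
  by apply: (le_trans (hK y yr)); apply: mono; exact: leq_addr.
by apply: (le_trans (hL y yr)); apply: mono; exact: leq_addl.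
Qed.

(* Coordinates of the inversion w = y / |y|^2 (equal to 0 at y = 0, by division by 0). *)
Definition inv_coord i (y : V) : R := y ord0 i / N2 y.

Lemma measurable_powN2 (k : R) :
  measurable_fun setT ((fun y : V => N2 y `^ k) : V -> measurableTypeR R).
Proof. exact: (measurableT_comp (measurable_powR _) measurable_N2). Qed.

Lemma admissible_powN2 (k : R) : admissible (fun y => N2 y `^ k).
Proof.
split; first exact: measurable_powN2.
(* The summand 1 serves k >= 0, where N2^k <= J^m; the summand r^k serves k < 0, where N2^k <=
   r^k. *)
move=> r r0; exists (1 + r `^ k), (Num.truncn `|k|).+1 => y yr.
rewrite ger0_norm ?powR_ge0//.
have J1 := J_ge1 y; have Np : 0 < N2 y by exact: lt_le_trans yr.
have Jm1 : 1 <= J y ^+ (Num.truncn `|k|).+1 by rewrite exprn_ege1.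
have rk0 := powR_ge0 r k.
have [k0|k0] := leP 0 k.
  apply: (@le_trans _ _ (J y ^+ (Num.truncn `|k|).+1)); last nra.
  rewrite -powR_mulrn ?(le_trans _ J1)//.
  apply: (@le_trans _ _ (J y `^ k)).
    by apply: ge0_ler_powR => //; rewrite ?nnegrE ?N2_ge0 ?(ltW (J_gt0 y))// /J; lra.
  apply: ler_powR => //; apply: ltW.
  by have := truncnS_gt `|k|; rewrite ger0_norm.
apply: (@le_trans _ _ (r `^ k)); last nra.
rewrite -[k]opprK !(powRN _ (- k)) lef_pV2 ?posrE ?powR_gt0//.
by apply: ge0_ler_powR; rewrite ?nnegrE ?oppr_ge0 ?(ltW k0) ?(ltW r0) ?(ltW Np).
Qed.

Lemma admissible_coord i : admissible (fun y => y ord0 i).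
Proof.
split; first exact: measurable_coord.
move=> r r0; exists 1, 1%N => y yr; rewrite mul1r expr1 /J.
have := le_sqr_N2 y i; rewrite -[y ord0 i ^+ 2]real_normK ?num_real//.
by have := sqr_ge0 (`|y ord0 i| - 1); nra.
Qed.

Lemma powN2_N1 (y : V) : N2 y `^ (-1) = (N2 y)^-1.
Proof. by rewrite powR_inv1// N2_ge0. Qed.

Lemma admissible_inv_coord i : admissible (inv_coord i).
Proof.
have -> : inv_coord i = fun y => y ord0 i * N2 y `^ (-1).
  by apply/funext => y; rewrite powN2_N1.
apply: admissibleM; [exact: admissible_coord|exact: admissible_powN2].
Qed.

Definition inv_monom l (y : V) : R := \prod_(i <- l) inv_coord i y.

Lemma admissible_inv_monom l : admissible (inv_monom l).
Proof.
elim: l => [|i l IH].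
  rewrite (_ : inv_monom _ = fun=> 1); first exact: admissible_cst.
  by apply/funext => y; rewrite /inv_monom big_nil.
rewrite (_ : inv_monom _ = fun y => inv_coord i y * inv_monom l y).
  by apply: admissibleM => //; exact: admissible_inv_coord.
by apply/funext => y; rewrite /inv_monom big_cons.
Qed.

(* [\sum_(m <- deletions i l) w^m] is the formal partial derivative in [w_i] of the monomial [w^l]. *)
Fixpoint deletions i l : seq (seq 'I_n) :=
  if l is j :: l' then (if i == j then [:: l'] else [::]) ++ map (cons j) (deletions i l') else [::].

Lemma size_deletions i l m : m \in deletions i l -> (size m).+1 = size l.
Proof.
elim: l m => [//|j l IH] m /=; rewrite mem_cat => /orP[|/mapP[m' /IH <- ->]//].
by case: ifP => //= _; rewrite inE => /eqP ->.
Qed.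

Lemma inv_monom_cons i l y : inv_monom (i :: l) y = inv_coord i y * inv_monom l y.
Proof. by rewrite /inv_monom big_cons. Qed.

(** Euler's identity for homogeneous polynomials: the sum of w_i d/dw_i multiplies w^l by its
    degree. *)
Lemma euler_deletions l y :
  \sum_i \sum_(m <- deletions i l) inv_monom (i :: m) y = (size l)%:R * inv_monom l y.
Proof.
elim: l => [|j l IH]; first by rewrite /= mul0r big1// => i _; rewrite big_nil.
have E i : \sum_(m <- deletions i (j :: l)) inv_monom (i :: m) y =
    (if i == j then inv_monom (j :: l) y else 0) +
    inv_coord j y * \sum_(m <- deletions i l) inv_monom (i :: m) y.
  rewrite /= big_cat/=; congr (_ + _).
    by case: eqP => [->|_]; rewrite ?big_seq1 ?big_nil.
  rewrite big_map mulr_sumr; apply: eq_bigr => m _.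
  by rewrite !inv_monom_cons mulrCA.
rewrite (eq_bigr _ (fun i _ => E i)) big_split/= -big_mkcond/= big_pred1_eq.
by rewrite -mulr_sumr IH inv_monom_cons -[(size (j :: l))%:R]nat1r; ring.
Qed.

Lemma sum_inv_coord_sqr y : \sum_i inv_coord i y ^+ 2 = (N2 y)^-1.
Proof.
under eq_bigr do rewrite expr_div_n.
rewrite -mulr_suml -/(N2 y); have [->|y0] := eqVneq (N2 y) 0; first by rewrite mul0r invr0.
by field.
Qed.

Lemma is_derive_coord (y : V) i j :
  is_derive (0 : R) (1 : R) (fun t : R => (y + t *: ei i) ord0 j) (i == j)%:R.
Proof.
have E : (fun t : R => (y + t *: ei i) ord0 j) = (fun t => y ord0 j + (i == j)%:R * t).
  by apply/funext => t; rewrite !mxE eqxx/= eq_sym mulrC.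
rewrite E.
have := is_deriveD (is_derive_cst (y ord0 j) (0 : R) (1 : R)) (is_deriveZ (i == j)%:R (is_derive_id (0 : R) (1 : R))).
move=> H; apply: (is_derive_eq H).
by rewrite add0r /GRing.scale/= mulr1.
Qed.

Lemma is_derive_N2 (y : V) i :
  is_derive (0 : R) (1 : R) (fun t : R => N2 (y + t *: ei i)) (2 * y ord0 i).
Proof.
have E : (fun t : R => N2 (y + t *: ei i)) = (fun t => N2 y + (2 * y ord0 i * t + t * t)).
  apply/funext => t; rewrite /N2.
  transitivity (\sum_j (y ord0 j ^+ 2 + (if j == i then 2 * y ord0 i * t + t * t else 0))).
    apply: eq_bigr => j _; rewrite !mxE eqxx/=; case: eqP => [->|_] /=; ring.
  by rewrite big_split/= -big_mkcond/= big_pred1_eq.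
rewrite E.
have id0 := is_derive_id (0 : R) (1 : R).
have H := is_deriveD (is_derive_cst (N2 y) (0 : R) (1 : R))
  (is_deriveD (is_deriveZ (2 * y ord0 i) id0) (is_deriveM id0 id0)).
apply: (is_derive_eq H).
by rewrite add0r /GRing.scale/= mulr1 !mul0r !addr0.
Qed.

Lemma is_derive_powN2 (k : R) (y : V) i : 0 < N2 y ->
  is_derive (0 : R) (1 : R) (fun t : R => N2 (y + t *: ei i) `^ k)
    (2 * k * (N2 y `^ k * inv_coord i y)).
Proof.
move=> y0.
have e0 : N2 (y + 0 *: ei i) = N2 y by rewrite scale0r addr0.
have H1 : is_derive (N2 (y + 0 *: ei i)) (1 : R) (fun x : R => x `^ k) (k * N2 y `^ (k - 1)).
  by rewrite e0; exact: is_derive1_powR.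
have H := @is_derive1_comp _ (fun x : R => x `^ k) (fun t : R => N2 (y + t *: ei i)) 0 _ _ H1 (is_derive_N2 y i).
apply: (is_derive_eq H).
rewrite powRB; last by rewrite (gt_eqF y0) implybT.
by rewrite powRr1 ?ltW// /inv_coord; ring.
Qed.

(** Since |w|^2 = 1/|y|^2, the derivative of w_j is delta_ij |w|^2 - 2 w_i w_j. Thus differentiation
    in y preserves polynomials in w and raises the degree by one, which is the reason for working
    with the inversion. *)
Lemma is_derive_inv_coord (y : V) i j : 0 < N2 y ->
  is_derive (0 : R) (1 : R) (fun t : R => inv_coord j (y + t *: ei i))
    ((i == j)%:R * (N2 y)^-1 - 2 * inv_coord i y * inv_coord j y).
Proof.
move=> y0.
have e0 : y + 0 *: ei i = y by rewrite scale0r addr0.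
have yn0 : N2 (y + 0 *: ei i) != 0 by rewrite e0 gt_eqF.
have H := is_deriveM (is_derive_coord y i j)
  (@is_deriveV _ (fun t : R => N2 (y + t *: ei i)) 0 _ 1 yn0 (is_derive_N2 y i)).
apply: (is_derive_eq H); rewrite e0 /GRing.scale/= /inv_coord.
by field; rewrite gt_eqF.
Qed.

Lemma is_derive_inv_monom (y : V) i l : 0 < N2 y ->
  is_derive (0 : R) (1 : R) (fun t : R => inv_monom l (y + t *: ei i))
    (- 2 * (size l)%:R * inv_coord i y * inv_monom l y +
     (N2 y)^-1 * \sum_(m <- deletions i l) inv_monom m y).
Proof.
move=> y0; have e0 : y + 0 *: ei i = y by rewrite scale0r addr0.
elim: l => [|j l IH].
  rewrite (_ : (fun _ => _) = cst 1); last by apply/funext => t; rewrite /inv_monom big_nil.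
  have := is_derive_cst (1 : R) (0 : R) (1 : R); rewrite /= big_nil !mulr0 !mul0r addr0.
  by [].
rewrite (_ : (fun _ => _) = (fun t : R => inv_coord j (y + t *: ei i) * inv_monom l (y + t *: ei i))); last first.
  by apply/funext => t; rewrite inv_monom_cons.
have H := is_deriveM (is_derive_inv_coord i j y0) IH.
apply: (is_derive_eq H); rewrite e0 /GRing.scale/= big_cat/= big_map.
rewrite [X in _ = _ + _ * (_ + X)](_ : _ = inv_coord j y * \sum_(m <- deletions i l) inv_monom m y); last first.
  by rewrite mulr_sumr; apply: eq_bigr => m _; rewrite inv_monom_cons.
rewrite [X in _ = _ + _ * (X + _)](_ : _ = (i == j)%:R * inv_monom l y); last first.
  by case: eqP => _; rewrite ?big_seq1 ?big_nil ?mul1r ?mul0r.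
by rewrite inv_monom_cons -nat1r; ring.
Qed.

End kernels.

(** * Orthogonality to all polynomials in the inversion *)

Section annihilation.
Context {R : realType} {n : nat}.
Local Notation V := 'rV[R]_n.
Local Notation mu := (lebesgue_rV n : {measure set V -> \bar R}).
Local Notation ei i := (delta_mx ord0 i : V).
Implicit Types (v w K : V -> R) (i : 'I_n) (l : seq 'I_n).

Variables (D : seq 'I_n -> V -> R) (r : R).
Hypotheses (r0 : 0 < r)
  (mD : forall b, measurable_fun setT (D b : V -> measurableTypeR R))
  (pD : forall i b, pder i (D b) (D (i :: b)))
  (rD : forall b, rapid (D b)) (fD : forall b, flat r (D b)).

(** The list b is a parameter because integration by parts trades a derivative of K for one
    direction of b; admissibility is bundled so that sums of integrals can be split. *)
Definition annihilates (b : seq 'I_n) K :=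
  admissible K /\ Rintegral mu setT (fun y => D b y * K y) = 0.

Lemma integrable_admissible b K : admissible K ->
  mu.-integrable setT (EFin \o (fun y => D b y * K y)).
Proof. by move=> [mK tK]; apply: (integrable_rapidM (r := r)) => //; exact: tK. Qed.

Lemma annihilatesD b K L : annihilates b K -> annihilates b L -> annihilates b (fun y => K y + L y).
Proof.
move=> [aK K0] [aL L0]; split; first exact: admissibleD.
under eq_Rintegral do rewrite mulrDr.
by rewrite RintegralD ?K0 ?L0 ?addr0//; exact: integrable_admissible.
Qed.

Lemma annihilatesZ b (c : R) K : annihilates b K -> annihilates b (fun y => c * K y).
Proof.
move=> [aK K0]; split; first exact: admissibleM (admissible_cst c) aK.
under eq_Rintegral do rewrite mulrCA.
by rewrite RintegralZl ?K0 ?mulr0//; exact: integrable_admissible.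
Qed.

Lemma annihilates0 b : annihilates b (fun=> 0).
Proof.
split; first exact: admissible_cst.
by under eq_Rintegral do rewrite mulr0; rewrite /Rintegral integral0.
Qed.

Lemma annihilates_sum b (I : eqType) (s : seq I) (K : I -> V -> R) :
  (forall j, j \in s -> annihilates b (K j)) -> annihilates b (fun y => \sum_(j <- s) K j y).
Proof.
elim: s => [|j s IH] H.
  rewrite (_ : (fun _ => _) = fun=> 0); first exact: annihilates0.
  by apply/funext => y; rewrite big_nil.
rewrite (_ : (fun _ => _) = fun y => K j y + \sum_(j <- s) K j y).
  apply: annihilatesD; first by apply: H; rewrite mem_head.
  by apply: IH => k ks; apply: H; rewrite inE ks orbT.
by apply/funext => y; rewrite big_cons.
Qed.

Lemma annihilates_pder b i K K' : annihilates (i :: b) K -> admissible K' ->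
  (forall y, 0 < N2 y -> is_derive (0 : R) (1 : R) (fun t : R => K (y + t *: ei i)) (K' y)) ->
  annihilates b K'.
Proof.
move=> [[mK tK] K0] [mK' tK'] dK; split => //.
have := integration_by_parts_pder r0 (mD b) (mD (i :: b)) mK mK' (pD i b) (rD b) (rD (i :: b))
  (fD b) (fD (i :: b)) (tK _ r0) (tK' _ r0) dK.
by rewrite K0 => /eqP; rewrite eq_sym oppr_eq0 => /eqP.
Qed.

Variable k : R.
Hypotheses (k1 : forall d : nat, k != d%:R) (k2 : forall d : nat, 2 * k + n%:R - 1 != d.+1%:R)
  (D0 : forall b, Rintegral mu setT (fun y => D b y * N2 y `^ k) = 0).

Definition inv_kernel l (y : V) : R := N2 y `^ k * inv_monom l y.
(** The factor 1/|y|^2 is |w|^2, so this stands for |y|^(2k) |w|^2 w^l, of degree two higher in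
    w. *)
Definition inv_kernelV l (y : V) : R := (N2 y)^-1 * inv_kernel l y.

Lemma admissible_inv_kernel l : admissible (inv_kernel l).
Proof. exact: admissibleM (admissible_powN2 k) (admissible_inv_monom l). Qed.

Lemma admissible_inv_kernelV l : admissible (inv_kernelV l).
Proof.
rewrite (_ : inv_kernelV l = fun y => N2 y `^ (-1) * inv_kernel l y).
  exact: admissibleM (admissible_powN2 (-1)) (admissible_inv_kernel l).
by apply/funext => y; rewrite powN2_N1.
Qed.

Definition dinv_kernel i l (y : V) : R :=
  2 * (k - (size l)%:R) * inv_kernel (i :: l) y + \sum_(m <- deletions i l) inv_kernelV m y.

Lemma is_derive_inv_kernel (y : V) i l : 0 < N2 y ->
  is_derive (0 : R) (1 : R) (fun t : R => inv_kernel l (y + t *: ei i)) (dinv_kernel i l y).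
Proof.
move=> y0; have e0 : y + 0 *: ei i = y by rewrite scale0r addr0.
have H := is_deriveM (is_derive_powN2 k i y0) (is_derive_inv_monom i l y0).
apply: (is_derive_eq H); rewrite e0 /GRing.scale/= /dinv_kernel /inv_kernelV /inv_kernel.
rewrite [X in _ = _ + X](_ : _ = (N2 y)^-1 * N2 y `^ k * \sum_(m <- deletions i l) inv_monom m y); last first.
  by rewrite mulr_sumr; apply: eq_bigr => m _; rewrite mulrA.
by rewrite inv_monom_cons; ring.
Qed.

Lemma admissible_dinv_kernel i l : admissible (dinv_kernel i l).
Proof.
apply: admissibleD.
  exact: admissibleM (admissible_cst _) (admissible_inv_kernel _).
elim: (deletions i l) => [|m s IH].
  by under eq_fun do rewrite big_nil; exact: admissible_cst.
under eq_fun do rewrite big_cons.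
by apply: admissibleD => //; exact: admissible_inv_kernelV.
Qed.

(* With d = size l + 1, this divides out |w|^2 w^l unless 2 k + n - 1 = d, an integer. *)
Lemma sum_dinv_kernel l (y : V) :
  \sum_i dinv_kernel i (i :: l) y =
  (2 * k + n%:R - 1 - (size l).+1%:R) * inv_kernelV l y.
Proof.
rewrite /dinv_kernel big_split/= -mulr_sumr.
have -> : \sum_i inv_kernel [:: i, i & l] y = inv_kernelV l y.
  rewrite /inv_kernelV -sum_inv_coord_sqr mulr_suml; apply: eq_bigr => i _.
  by rewrite /inv_kernel !inv_monom_cons; ring.
have -> : \sum_i \sum_(m <- (if i == i then [:: l] else [::]) ++ [seq i :: m | m <- deletions i l]) inv_kernelV m y =
    n%:R * inv_kernelV l y + (size l)%:R * inv_kernelV l y.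
  under eq_bigr do rewrite eqxx big_cat/= big_seq1 big_map.
  rewrite big_split/= sumr_const card_ord mulr_natl; congr (_ + _).
  rewrite /inv_kernelV /inv_kernel.
  transitivity ((N2 y)^-1 * N2 y `^ k * \sum_i \sum_(m <- deletions i l) inv_monom (i :: m) y).
    rewrite mulr_sumr; apply: eq_bigr => i _; rewrite mulr_sumr; apply: eq_bigr => m _; ring.
  by rewrite euler_deletions; ring.
by rewrite -nat1r; ring.
Qed.

(* Induction on the degree d of w^l: [sum_dinv_kernel] yields |w|^2 w^m for all m of degree d - 1, and subtracting these
   terms from the derivative [dinv_kernel i l] leaves a multiple of w_i w^l. *)
Lemma annihilates_inv_kernel l b : annihilates b (inv_kernel l).
Proof.
move: {2}(size l) (erefl (size l)) => d; elim: d l b => [|d IH] l b.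
  move=> /size0nil ->; rewrite (_ : inv_kernel [::] = fun y => N2 y `^ k).
    by split; [exact: admissible_powN2|exact: D0].
  by apply/funext => y; rewrite /inv_kernel /inv_monom big_nil mulr1.
case: l => [//|i l] /= [sl].
(* Degree d with the list j :: b' gives degree d + 1 with the list b'; this is why the induction
   quantifies over b. *)
have dG j m b' : size m = d -> annihilates b' (dinv_kernel j m).
  move=> sm; apply: (annihilates_pder (IH m (j :: b') sm)); first exact: admissible_dinv_kernel.
  by move=> y y0; exact: is_derive_inv_kernel.
have VG m : (size m).+1 = d -> annihilates b (inv_kernelV m).
  move=> sm; have c0 : 2 * k + n%:R - 1 - (size m).+1%:R != 0 by rewrite subr_eq0 k2.
  rewrite (_ : inv_kernelV m = fun y => (2 * k + n%:R - 1 - (size m).+1%:R)^-1 *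
      \sum_(j <- index_enum 'I_n) dinv_kernel j (j :: m) y); last first.
    by apply/funext => y; rewrite sum_dinv_kernel mulKf.
  by apply: annihilatesZ; apply: annihilates_sum => j _; exact: dG.
have c0 : 2 * (k - (size l)%:R) != 0 by rewrite mulf_neq0 ?pnatr_eq0// subr_eq0 k1.
rewrite (_ : inv_kernel _ = fun y => (2 * (k - (size l)%:R))^-1 *
   (dinv_kernel i l y + (-1) * \sum_(m <- deletions i l) inv_kernelV m y)); last first.
  by apply/funext => y; rewrite /dinv_kernel mulN1r addrK mulKf.
apply: annihilatesZ; apply: annihilatesD; first exact: dG.
apply: annihilatesZ; apply: annihilates_sum => m /size_deletions sm.
by apply: VG; rewrite sm.
Qed.

Definition inv_pt (y : V) : V := (N2 y)^-1 *: y.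

Lemma N2B_scale (a b : R) (y z : V) :
  N2 (a *: y - b *: z) = a ^+ 2 * N2 y - 2 * a * b * (\sum_i y ord0 i * z ord0 i) + b ^+ 2 * N2 z.
Proof.
rewrite /N2 !mulr_sumr -sumrB -big_split/=; apply: eq_bigr => i _.
by rewrite !mxE; ring.
Qed.

(** The distance formula of the inversion; it translates concentration in w into concentration in
    y. *)
Lemma N2_inv_ptB (y z : V) : N2 y != 0 -> N2 z != 0 ->
  N2 (inv_pt y - inv_pt z) = N2 (y - z) / (N2 y * N2 z).
Proof.
move=> y0 z0; have := N2B_scale 1 1 y z; rewrite !scale1r => ->.
by rewrite N2B_scale; field; rewrite y0 z0.
Qed.

(* A polynomial in w = inv_pt y with a strict maximum at y = z; its powers concentrate there. *)
Definition bump (e : R) (z y : V) : R := 1 - e * N2 (inv_pt y - inv_pt z).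

Lemma annihilates_bump e z m :
  admissible (fun y => N2 y `^ k * bump e z y ^+ m) /\
  Rintegral mu setT (fun y => D [::] y * (N2 y `^ k * bump e z y ^+ m)) = 0.
Proof.
(* A monomial is carried along: expanding one factor [bump], a quadratic polynomial in w, multiplies
   it by a constant, by w_i or by w_i^2. *)
suff H l : annihilates [::] (fun y => inv_kernel l y * bump e z y ^+ m).
  have E : (fun y => inv_kernel [::] y * bump e z y ^+ m) = (fun y => N2 y `^ k * bump e z y ^+ m).
    by apply/funext => y; rewrite /inv_kernel /inv_monom big_nil mulr1.
  by have := H [::]; rewrite E.
elim: m l => [|m IH] l.
  under eq_fun do rewrite expr0 mulr1.
  exact: annihilates_inv_kernel.
have E y : bump e z y = 1 - e * N2 (inv_pt z) +
    \sum_i (2 * e * inv_pt z ord0 i * inv_coord i y + - e * (inv_coord i y * inv_coord i y)).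
  rewrite /bump; have := N2B_scale 1 1 (inv_pt y) (inv_pt z); rewrite !scale1r => ->.
  have ci i : inv_pt y ord0 i = inv_coord i y by rewrite mxE mulrC.
  have S1 : N2 (inv_pt y) = \sum_i inv_coord i y * inv_coord i y.
    by apply: eq_bigr => i _; rewrite ci expr2.
  have S2 : \sum_i inv_pt y ord0 i * inv_pt z ord0 i = \sum_i inv_coord i y * inv_pt z ord0 i.
    by apply: eq_bigr => i _; rewrite ci.
  have S3 : \sum_i 2 * e * inv_pt z ord0 i * inv_coord i y = 2 * e * \sum_i inv_coord i y * inv_pt z ord0 i.
    by rewrite mulr_sumr; apply: eq_bigr => i _; ring.
  by rewrite big_split/= -mulr_sumr S1 S2 S3; ring.
rewrite (_ : (fun _ => _) = fun y => (1 - e * N2 (inv_pt z)) * (inv_kernel l y * bump e z y ^+ m) +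
   \sum_(i <- index_enum 'I_n) (2 * e * inv_pt z ord0 i * (inv_kernel (i :: l) y * bump e z y ^+ m)
     + - e * (inv_kernel [:: i, i & l] y * bump e z y ^+ m))); last first.
  apply/funext => y; rewrite exprSr {2}E mulrDr mulrDr; congr (_ + _); first by ring.
  rewrite !mulr_sumr; apply: eq_bigr => i _.
  by rewrite /inv_kernel !inv_monom_cons; ring.
apply: annihilatesD; first by apply: annihilatesZ.
by apply: annihilates_sum => i _; apply: annihilatesD; apply: annihilatesZ.
Qed.

End annihilation.

(** * Unique continuation *)

Section unique_continuation.
Context {R : realType} {n : nat}.
Local Notation V := 'rV[R]_n.
Local Notation mu := (lebesgue_rV n : {measure set V -> \bar R}).
Local Notation ei i := (delta_mx ord0 i : V).

Lemma continuous_N2 : continuous (@N2 R n).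
Proof.
apply: continuous_big => [|i _ y]; first exact: add_continuous.
apply: (@continuous_comp _ _ _ (fun z : V => z ord0 i) (fun t : R => t ^+ 2)).
  exact: coord_continuous.
exact: exprn_continuous.
Qed.

Lemma continuous_powN2 (k : R) (y : V) : 0 < N2 y -> {for y, continuous (fun y => N2 y `^ k)}.
Proof.
move=> y0; apply: (@continuous_comp _ _ _ (@N2 R n) (fun t : R => t `^ k)); first exact: continuous_N2.
apply: differentiable_continuous; apply/derivable1_diffP.
by have [] := is_derive1_powR k y0.
Qed.

Lemma cube_out (x y : V) (e : R) : 0 < e -> ~ cube x e y -> e ^+ 2 <= N2 (y - x).
Proof.
move=> e0 xy; rewrite leNgt; apply/negP => h; apply: xy => i.
have := le_lt_trans (le_sqr_N2 (y - x) i) h; rewrite !mxE.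
rewrite -[(_ - _) ^+ 2]real_normK ?num_real// ltr_pXn2r ?nnegrE ?(ltW e0)//.
by rewrite ltr_norml /= in_itv/= => /andP[h1 h2]; apply/andP; split; lra.
Qed.

Lemma cube_in (x y : V) (e : R) : cube x e y -> N2 (y - x) <= n%:R * e ^+ 2.
Proof.
move=> xy; rewrite mulr_natl -[in leRHS](card_ord n) -sumr_const; apply: ler_sum => i _.
rewrite !mxE; have := xy i; rewrite /= in_itv/= => /andP[h1 h2]; nra.
Qed.

(** Suppose h(y0) is nonzero and let H = h(y0) h |y|^(2k), so that H > c > 0 on a cube of radius e
    around y0. On the support of h the bump q lies in [0, 1]; it is at most a outside this cube and
    at least b > a on a smaller cube of radius g. As H q^m has integral 0, c b^m (2g)^n <= a^m times
    the integral of |H|, which fails for large m. *)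
Lemma eq0_of_bumps (h : V -> R) (k r : R) : 0 < r ->
  continuous h -> rapid h -> flat r h ->
  (forall e z m, admissible (fun y => N2 y `^ k * bump e z y ^+ m) /\
    Rintegral mu setT (fun y => h y * (N2 y `^ k * bump e z y ^+ m)) = 0) ->
  forall y, h y = 0.
Proof.
move=> r0 ch rh fh h0 y0; apply: contrapT => /eqP hy0.
have mh := continuous_measurable_rV ch.
have out y : h y != 0 -> r <= N2 y.
  by move=> hy; rewrite leNgt; apply/negP => yr; move: hy; rewrite fh ?eqxx.
have ry0 := out _ hy0; have N0 : 0 < N2 y0 by exact: lt_le_trans ry0.
pose H y := h y0 * (h y * N2 y `^ k).
pose c := H y0 / 2.
have c0 : 0 < c by rewrite divr_gt0// /H mulrA mulr_gt0 ?powR_gt0// -expr2 exprn_even_gt0.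
have [e e0 He] : exists2 e, 0 < e & cube y0 e `<=` [set y | c < H y].
  have HC : H y @[y --> y0] --> H y0.
    exact: (cvgM (cvg_cst (h y0)) (cvgM (ch y0) (continuous_powN2 (k := k) N0))).
  have cH : c < H y0 by rewrite /c ltr_pdivrMr// ltr_pMr; [lra|rewrite /c in c0; lra].
  have Hn : nbhs y0 [set y | c < H y] by exact: (cvgr_gt _ HC _ cH).
  have [e e0 He] := open_cube (open_interior [set y | c < H y]) Hn.
  by exists e => //; apply: subset_trans He _; exact: interior_subset.
have HN y : H y != 0 -> r <= N2 y.
  by move=> Hy; apply: out; apply: contraNneq Hy => hy; rewrite /H hy mul0r mulr0.
(* A lower bound for the squared distance of the inverted points when y is outside the cube: with S
   = |y - y0|^2 >= e^2 and |y|^2 <= 2 S + 2 |y0|^2, the quotient S / (|y|^2 |y0|^2) is least at S =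
   e^2. *)
pose d := e ^+ 2 / ((2 * e ^+ 2 + 2 * N2 y0) * N2 y0).
have e20 : 0 < e ^+ 2 by rewrite exprn_gt0.
have d0 : 0 < d by rewrite divr_gt0// mulr_gt0//; lra.
(* Where N2 >= r, inverted points have squared distance at most 4/r, so this choice keeps the bump
   nonnegative. *)
pose eps := r / 4.
have eps0 : 0 < eps by rewrite divr_gt0.
pose q := bump eps y0.
have dist y : r <= N2 y -> N2 (inv_pt y - inv_pt y0) = N2 (y - y0) / (N2 y * N2 y0).
  by move=> yr; rewrite N2_inv_ptB ?gt_eqF// (lt_le_trans r0).
have q01 y : r <= N2 y -> 0 <= q y <= 1.
  move=> yr; have Ny : 0 < N2 y by exact: lt_le_trans yr.
  have D0 := N2_ge0 (inv_pt y - inv_pt y0).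
  rewrite /q /bump; apply/andP; split; last by nra.
  have : N2 (inv_pt y - inv_pt y0) <= 4 / r.
    rewrite dist// ler_pdivrMr ?mulr_gt0//.
    have h1 := N2D y (- y0); rewrite N2N in h1.
    apply: (le_trans h1).
    rewrite mulrAC ler_pdivlMr//; nra.
  move=> h1; have : eps * N2 (inv_pt y - inv_pt y0) <= eps * (4 / r) by rewrite ler_wpM2l// ltW.
  have -> : eps * (4 / r) = 1 by rewrite /eps; field; rewrite gt_eqF.
  lra.
pose a := 1 - eps * d; pose b := 1 - eps * (d / 2).
have qa y : r <= N2 y -> ~ cube y0 e y -> q y <= a.
  move=> yr yc; rewrite /q /bump /a lerD2l lerN2 ler_wpM2l ?(ltW eps0)//.
  have Ny : 0 < N2 y by exact: lt_le_trans yr.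
  rewrite dist// /d; have := cube_out e0 yc; set S := N2 (y - y0) => eS.
  have h1 := N2D (y - y0) y0; rewrite subrK -/S in h1.
  rewrite ler_pdivlMr ?mulr_gt0// mulrAC ler_pdivrMr ?mulr_gt0//; last by lra.
  have h2 : e ^+ 2 * N2 y <= S * (2 * e ^+ 2 + 2 * N2 y0) by nra.
  by have := ler_wpM2r (ltW N0) h2; lra.
(* The radius g makes the squared distance of the inverted points at most n g^2 / (r |y0|^2) <= d/2
   on the small cube, whence the lower bound b. *)
have [g g0 [ge gd]] : exists2 g, 0 < g & g <= e /\ n%:R * g ^+ 2 <= d / 2 * (r * N2 y0).
  pose t := d / 2 * (r * N2 y0).
  have d2 : 0 < d / 2 by lra.
  have t0 : 0 < t by apply: mulr_gt0 => //; exact: mulr_gt0.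
  have n1 : 0 < n%:R + 1 :> R by rewrite ltr_wpDl.
  exists (Num.min e (Num.min 1 (t / (n%:R + 1)))).
    by rewrite !lt_min e0 ltr01 divr_gt0.
  split; first by rewrite ge_min lexx.
  set g := Num.min _ _.
  have g0 : 0 < g by rewrite !lt_min e0 ltr01 divr_gt0.
  have g1 : g <= 1 by rewrite !ge_min lexx orbT.
  have gt : g <= t / (n%:R + 1) by rewrite !ge_min lexx !orbT.
  rewrite ler_pdivlMr// in gt; rewrite -/t.
  have nn : 0 <= n%:R :> R by [].
  nra.
have qb y : cube y0 g y -> b <= q y /\ c <= H y.
  move=> yg; have yc : cube y0 e y.
    by move=> i; have := yg i; rewrite /= !in_itv/= => /andP[h1 h2]; apply/andP; split; lra.
  have Hy := He y yc; rewrite /= in Hy; split; last exact: ltW.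
  have yr : r <= N2 y by apply: HN; rewrite gt_eqF// (lt_trans c0).
  have Ny : 0 < N2 y by exact: lt_le_trans yr.
  rewrite /q /bump /b lerD2l lerN2 ler_wpM2l ?(ltW eps0)// dist//.
  rewrite ler_pdivrMr ?mulr_gt0//; apply: (le_trans (cube_in yg)); apply: (le_trans gd).
  by rewrite ler_wpM2l ?ler_wpM2r// ltW// divr_gt0.
have y0g : cube y0 g y0.
  by move=> i; rewrite /= in_itv/=; apply/andP; split; lra.
(* This bounds eps d = d r / 4 by 1/4 and makes a positive. *)
have dr : d * r <= 1.
  by rewrite /d mulrAC ler_pdivrMr ?mulr_gt0//; [nra|lra].
have a0 : 0 < a by rewrite /a /eps; lra.
have ab : a < b by rewrite /a /b; nra.
have b0 : 0 < b by exact: lt_trans ab.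
have aK : admissible (fun y : V => N2 y `^ k).
  by have [] := h0 0 0 0%N; under eq_fun do rewrite expr0 mulr1.
have iH (K : V -> R) : admissible K -> mu.-integrable setT (EFin \o (fun y => h y0 * (h y * K y))).
  move=> [mK tK]; apply: (@integrableZl _ _ _ _ _ measurableT (h y0) (EFin \o (fun y => h y * K y))).
  by apply: (integrable_rapidM (r := r)) => //; exact: tK.
have iH1 : mu.-integrable setT (EFin \o H) by exact: iH.
have iHa : mu.-integrable setT (EFin \o (fun y => `|H y|)) by exact: (integrable_norm iH1).
have mG : measurable (cube y0 g) by exact: measurable_cube.
have muG : mu (cube y0 g) = ((2 * g) ^+ n)%:E by exact: lebesgue_cube.
have iG : mu.-integrable setT (EFin \o (\1_(cube y0 g) : V -> R)).
  apply/integrableP; split; first by apply/measurable_EFinP; exact: measurable_indic.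
  rewrite (eq_integral (fun y => (\1_(cube y0 g) y)%:E)); last by move=> y _ /=; rewrite ger0_norm.
  by rewrite integral_indic// setIT muG ltry.
pose C := Rintegral mu setT (fun y => `|H y|).
(* On the small cube H q^m >= c b^m, on the rest of the large cube it is nonnegative, and outside it
   is at least - a^m |H|; integrating these bounds gives the inequality. *)
have key m : c * (2 * g) ^+ n <= C * (a / b) ^+ m.
  have [am hm] := h0 eps y0 m.
  have ineq y : c * b ^+ m * \1_(cube y0 g) y - a ^+ m * `|H y| <= h y0 * (h y * (N2 y `^ k * q y ^+ m)).
    have -> : h y0 * (h y * (N2 y `^ k * q y ^+ m)) = H y * q y ^+ m by rewrite /H; ring.
    have am0 : 0 <= a ^+ m by rewrite exprn_ge0// ltW.
    have [Hy0|Hy0] := eqVneq (H y) 0.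
      rewrite Hy0 normr0 mulr0 subr0 mul0r indicE; case: (boolP (y \in _)) => [|_]; last by rewrite mulr0.
      by rewrite inE => /qb[_]; rewrite Hy0 leNgt c0.
    have /andP[q0 q1] := q01 y (HN y Hy0).
    have qm0 : 0 <= q y ^+ m by exact: exprn_ge0.
    have aH : 0 <= a ^+ m * `|H y| by rewrite mulr_ge0.
    rewrite indicE; case: (boolP (y \in _)) => [|].
      rewrite inE => /qb[qy Hy]; rewrite mulr1.
      have : c * b ^+ m <= H y * q y ^+ m.
        by apply: ler_pM => //; rewrite ?(ltW c0) ?exprn_ge0 ?(ltW b0)// lerXn2r ?nnegrE ?(ltW b0).
      lra.
    rewrite mulr0 sub0r => _; have [yc|yc] := pselect (cube y0 e y).
      have := He y yc; rewrite /= => Hy.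
      have : 0 <= H y * q y ^+ m by rewrite mulr_ge0// ltW// (lt_trans c0).
      lra.
    rewrite lerNl -mulNr; apply: (@le_trans _ _ (`|H y| * q y ^+ m)).
      by rewrite ler_wpM2r// -normrN ler_norm.
    rewrite mulrC ler_wpM2r// lerXn2r ?nnegrE ?(ltW a0)//.
    exact: qa (HN y Hy0) yc.
  have i1 : mu.-integrable setT (EFin \o (fun y => c * b ^+ m * \1_(cube y0 g) y)).
    exact: (@integrableZl _ _ _ _ _ measurableT _ _ iG).
  have i2 : mu.-integrable setT (EFin \o (fun y => a ^+ m * `|H y|)).
    exact: (@integrableZl _ _ _ _ _ measurableT _ _ iHa).
  have := @le_Rintegral _ _ _ mu setT _ _ measurableT (integrableB measurableT i1 i2) (iH _ am) (fun y _ => ineq y).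
  have i3 : mu.-integrable setT (EFin \o (fun y => h y * (N2 y `^ k * bump eps y0 y ^+ m))).
    by apply: (integrable_rapidM (r := r)) => //; [case: am|case: am => _; apply].
  rewrite RintegralB// !RintegralZl//.
  rewrite hm mulr0 -/C.
  have -> : Rintegral mu setT (fun y => \1_(cube y0 g) y) = (2 * g) ^+ n.
    by rewrite /Rintegral integral_indic// setIT muG.
  rewrite subr_le0 => h1; rewrite expr_div_n mulrA ler_pdivlMr ?exprn_gt0//.
  by rewrite mulrAC (le_trans h1)// mulrC.
have cg : 0 < c * (2 * g) ^+ n by rewrite mulr_gt0// exprn_gt0// mulr_gt0.
have ab1 : `|a / b| < 1 by rewrite ger0_norm ?divr_ge0 ?(ltW a0) ?(ltW b0)// ltr_pdivrMr// mul1r.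
have /cvgr_lt/(_ _ cg)[M _ /(_ M (leqnn M))/=] := cvg_geometric C ab1.
by rewrite ltNge key.
Qed.

(** The first condition on k excludes p = 0, 2, 4, ..., where |y|^p is a polynomial with only
    finitely many nonzero derivatives; the second keeps the coefficient in [sum_dinv_kernel]
    nonzero. *)
Lemma unique_continuation (D : seq 'I_n -> V -> R) (k : R) (U E : set V) :
  (forall b, continuous (D b)) ->
  (forall i b, pder i (D b) (D (i :: b))) -> (forall b, rapid (D b)) ->
  (forall d : nat, k != d%:R) -> (forall d : nat, 2 * k + n%:R - 1 != d.+1%:R) ->
  open U -> (forall x, U x -> D [::] x = 0) -> E `<=` U -> (0 < lebesgue_outer E)%E ->
  (forall x, E x -> Rintegral mu setT (fun y => D [::] (x + y) * N2 y `^ k) = 0) ->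
  forall x, D [::] x = 0.
Proof.
move=> cD pD rD k1 k2 oU DU EU E0 FE.
have mD b := continuous_measurable_rV (cD b).
have [mk tk] := @admissible_powN2 R n k.
have [x Ex F0] := common_zero mD pD rD mk tk oU DU EU E0 FE.
have Ux := EU _ Ex.
have [r r0 fr] := flat_shift oU Ux.
pose G b y := D b (x + y).
have cG b : continuous (G b).
  move=> y; apply: (@continuous_comp _ _ _ (fun y => x + y) (D b)); last exact: cD.
  exact: (cvgD (cvg_cst x) (@cvg_id _ (nbhs y))).
have fG b : flat r (G b) by exact/fr/vanishing_pders.
have H := @eq0_of_bumps (G [::]) k r r0 (cG [::]) (rapid_shift x (rD [::])) (fG [::])
  (@annihilates_bump R n G r r0 (fun b => measurable_shift x (mD b))
   (fun i b => pder_shift x (pD i b)) (fun b => rapid_shift x (rD b)) fG k k1 k2 F0).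
by move=> z; have := H (z - x); rewrite /G addrC subrK.
Qed.

End unique_continuation.

(** * Positivity of Gamma *)

Section gamma.
Context {R : realType}.
Local Notation leb := (@lebesgue_measure R).

Lemma measurable_powR_expRN (z : R) : measurable_fun [set: measurableTypeR R]
  ((fun t : R => t `^ (z - 1) * expR (- t)) : measurableTypeR R -> measurableTypeR R).
Proof.
apply: measurable_funM; first exact: measurable_powR.
apply: continuous_measurable_fun => x; apply: continuous_comp; first exact: opp_continuous.
exact: continuous_expR.
Qed.

(** For z < 1 the integrand is unbounded at 0, so the fundamental theorem is used on [1/(k+1), 1]
    and the bound passes to the increasing limit. *)
Lemma integral_powR01 (z : R) : 0 < z ->
  (\int[leb]_(t in `]0%R, 1%R]) (t `^ (z - 1))%:E <= (z^-1)%:E)%E.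
Proof.
move=> z0.
pose F (k : nat) : set (measurableTypeR R) := `[k.+1%:R^-1, 1]%classic.
have FU : `]0, 1]%classic = \bigcup_k F k :> set (measurableTypeR R).
  apply/seteqP; split => [t|t [k _]]; rewrite /F /= !in_itv/=.
    move=> /andP[t0 t1]; exists (Num.truncn t^-1) => //=; rewrite in_itv/= t1 andbT.
    by rewrite invf_ple ?posrE// ltW// truncnS_gt.
  by move=> /andP[kt ->]; rewrite (lt_le_trans _ kt)// invr_gt0.
have mF k : measurable (F k) by exact: measurable_itv.
have ndF : nondecreasing_seq F.
  move=> k m km; apply/subsetPset => t; rewrite /F /= !in_itv/= => /andP[kt ->].
  by rewrite andbT (le_trans _ kt)// lef_pV2 ?posrE// ler_nat.
have mp : measurable_fun [set: measurableTypeR R] (fun t : R => (t `^ (z - 1))%:E).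
  by apply/measurable_EFinP; exact: measurable_powR.
rewrite FU.
have H : (\int[leb]_(t in F i) (t `^ (z - 1))%:E)%E @[i --> \oo] -->
    (\int[leb]_(t in \bigcup_i F i) (t `^ (z - 1))%:E)%E.
  apply: ge0_nondecreasing_set_cvg_integral => //.
  - by move=> i; exact: measurable_funTS.
  - by move=> i t _; rewrite lee_fin powR_ge0.
rewrite -(cvg_lim _ H)//; apply: lime_le; first by apply/cvg_ex; eexists; exact: H.
apply: nearW => k; rewrite /F.
pose G (t : R) := z^-1 * t `^ z.
have k0 : 0 < k.+1%:R^-1 :> R by rewrite invr_gt0.
have dG (t : R) : 0 < t -> is_derive t (1 : R) G (t `^ (z - 1)).
  move=> t0; have := is_deriveZ z^-1 (is_derive1_powR z t0).
  move=> H1; apply: (is_derive_eq H1); rewrite /GRing.scale/= mulKf// gt_eqF//.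
have cp (t : R) : 0 < t -> {for t, continuous (fun t : R => t `^ (z - 1))}.
  move=> t0; apply: differentiable_continuous; apply/derivable1_diffP.
  by have [] := is_derive1_powR (z - 1) t0.
have cG (t : R) : 0 < t -> {for t, continuous G}.
  move=> t0; apply: differentiable_continuous; apply/derivable1_diffP.
  by have [] := dG t t0.
have [k1|k1] := eqVneq (k.+1%:R^-1 : R) 1.
  rewrite k1 set_itv1 integral_set1 lee_fin invr_ge0 ltW//.
have k1' : k.+1%:R^-1 < 1 :> R by rewrite lt_neqAle k1 invf_le1// ler1n.
rewrite (@continuous_FTC2 _ _ G)//.
- by rewrite /G powR1 mulr1 -EFinB lee_fin gerBl mulr_ge0 ?powR_ge0// invr_ge0 ltW.
- apply: continuous_in_subspaceT => t; rewrite inE/= in_itv/= => /andP[kt _].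
  by apply: cp; exact: lt_le_trans kt.
- split.
  + move=> t; rewrite in_itv/= => /andP[kt _].
    by have [] := dG t (lt_trans k0 kt).
  + by apply: cvg_at_right_filter; exact: cG.
  + by apply: cvg_at_left_filter; exact: cG.
- move=> t; rewrite in_itv/= => /andP[kt _].
  by rewrite derive1E; have [_ ->] := dG t (lt_trans k0 kt).
Qed.

(** From exp t = exp(t/k)^k >= (t/k)^k, where k is an integer above |z - 1| plus two; the two extra
    powers pay for 1 + t^2 <= 2 t^2. *)
Lemma powR_expRN_le (z : R) : exists C, forall t : R, 1 <= t ->
  t `^ (z - 1) * expR (- t) <= C * (1 + t ^+ 2)^-1.
Proof.
pose m := (Num.truncn `|z - 1|).+1.
pose k := m.+2.
exists (2 * k%:R ^+ k) => t t1.
have t0 : 0 < t by exact: lt_le_trans t1.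
have p0 : 0 < 1 + t ^+ 2 by have := sqr_ge0 t; lra.
rewrite ler_pdivlMr// expRN -mulrA mulrCA ler_pdivrMl ?expR_gt0//.
have h1 : t `^ (z - 1) <= t ^+ m.
  rewrite -powR_mulrn ?(ltW t0)//; apply: ler_powR => //; apply: ltW.
  by apply: le_lt_trans (ler_norm _) _; exact: truncnS_gt.
have h2 : t ^+ k <= k%:R ^+ k * expR t.
  have kp : 0 < k%:R :> R by rewrite ltr0n.
  have -> : expR t = expR (t / k%:R) ^+ k.
    by rewrite -expRM_natl; congr expR; rewrite mulrC divfK// gt_eqF.
  rewrite -exprMn lerXn2r ?nnegrE ?(ltW t0) ?mulr_ge0 ?expR_ge0//.
  have := expR_ge1Dx (t / k%:R) => h.
  rewrite -ler_pdivrMl// mulrC; lra.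
have tm : 0 <= t ^+ m by rewrite exprn_ge0// ltW.
have h3 : t ^+ k = t ^+ m * t ^+ 2 by rewrite /k -exprD addn2.
apply: (@le_trans _ _ (t ^+ m * (1 + t ^+ 2))); first by rewrite ler_wpM2r// ltW.
apply: (@le_trans _ _ (2 * t ^+ k)); last first.
  by move: h2; set B := k%:R ^+ k; set T := t ^+ k; lra.
have t2 : 1 <= t ^+ 2 by rewrite exprn_ege1.
by rewrite h3; nra.
Qed.

(** Finiteness is half of the work, because [Rintegral] sends an infinite integral to 0. The lower
    bound comes from the interval [1, 2]. *)
Lemma Gamma_gt0 (z : R) : 0 < z -> 0 < Gamma z.
Proof.
move=> z0; rewrite /Gamma /Rintegral.
set g := (fun t : R => t `^ (z - 1) * expR (- t)).
have g0 t : 0 <= g t by rewrite mulr_ge0 ?powR_ge0 ?expR_ge0.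
have mg (A : set (measurableTypeR R)) : measurable_fun A (fun t : R => (g t)%:E).
  by apply: measurable_funTS; apply/measurable_EFinP; exact: measurable_powR_expRN.
have mI1 : measurable (`]0, 1]%classic : set (measurableTypeR R)) by exact: measurable_itv.
have mI2 : measurable (`]1, +oo[%classic : set (measurableTypeR R)) by exact: measurable_itv.
have EI : `]0, +oo[%classic = `]0, 1]%classic `|` `]1, +oo[%classic :> set (measurableTypeR R).
  apply/seteqP; split => t; rewrite /= !in_itv/= !andbT.
    by move=> t0; have [t1|t1] := leP t 1; [left; apply/andP|right].
  by move=> [/andP[]//|]; exact: lt_trans.
have fin : (\int[leb]_(t in `]0%R, +oo[) (g t)%:E < +oo)%E.
  rewrite EI ge0_integral_setU//; last first.
    apply/disj_setPLR => t /=; rewrite !in_itv/= andbT => /andP[_ t1].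
    by apply/negP; rewrite -leNgt.
    by move=> t _; rewrite lee_fin.
  apply: lte_add_pinfty.
    apply: le_lt_trans (ltry z^-1); apply: le_trans (integral_powR01 z0).
    apply: ge0_le_integral => //.
    - by move=> t _; rewrite lee_fin.
    - by apply: measurable_funTS; apply/measurable_EFinP; exact: measurable_powR.
    move=> t; rewrite /= in_itv/= => /andP[t0 t1]; rewrite lee_fin /g ler_piMr ?powR_ge0//.
    by rewrite -expR0 ler_expR oppr_le0 ltW.
  have [C hC] := powR_expRN_le z.
  have iC : leb.-integrable `]1, +oo[ (fun t : R => C%:E * ((1 + t ^+ 2)^-1)%:E)%E.
    apply: integrableZl => //; exact: integrableS (@integrable_oneDsqrV R).
  have [mC fC] := integrableP _ _ _ iC.
  apply: le_lt_trans fC; apply: ge0_le_integral => //.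
  - by move=> t _; rewrite lee_fin.
  - exact: measurableT_comp.
  move=> t; rewrite /= in_itv/= andbT => t1.
  by rewrite lee_fin (le_trans (hC t (ltW t1)))// ler_norm.
(* A lower bound of the integrand on [1, 2], an interval of length 1; the minimum covers both signs
   of z - 1. *)
pose c := Num.min 1 (2 `^ (z - 1)) * expR (- 2).
have c0 : 0 < c by rewrite mulr_gt0 ?expR_gt0// lt_min ltr01 powR_gt0.
have lb : (c%:E <= \int[leb]_(t in `]0%R, +oo[) (g t)%:E)%E.
  have mJ : measurable (`[1, 2]%classic : set (measurableTypeR R)) by exact: measurable_itv.
  apply: (@le_trans _ _ (\int[leb]_(t in `[1%R, 2%R]) c%:E)%E).
    have m12 : leb (`[1, 2]%classic : set (measurableTypeR R)) = 1%:E.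
      by rewrite lebesgue_measure_itv/= lte_fin ltr1n -EFinB; congr EFin; lra.
    by rewrite integral_cst// [X in (_ * X)%E]m12 mule1.
  apply: (@le_trans _ _ (\int[leb]_(t in `[1%R, 2%R]) (g t)%:E)%E).
    apply: ge0_le_integral => //.
    - by move=> t _; rewrite lee_fin ltW.
    move=> t; rewrite /= in_itv/= => /andP[t1 t2]; rewrite lee_fin.
    have t0 : 0 < t by exact: lt_le_trans t1.
    apply: ler_pM; rewrite ?expR_ge0 ?le_min ?ler01 ?powR_ge0//; last first.
      by rewrite ler_expR lerN2.
    have [z1|z1] := leP 0 (z - 1).
      by rewrite ge_min -[X in X <= _](powRr0 t) ler_powR.
    rewrite ge_min; apply/orP; right.
    rewrite -[z - 1]opprK !(powRN _ (- (z - 1))) lef_pV2 ?posrE ?powR_gt0//.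
    by apply: ge0_ler_powR; rewrite ?nnegrE ?oppr_ge0 ?(ltW z1) ?(ltW t0).
  apply: ge0_subset_integral => //.
  - by move=> t _; rewrite lee_fin.
  - move=> t; rewrite /= !in_itv/= andbT => /andP[t1 _]; exact: lt_le_trans t1.
have fn : (\int[leb]_(t in `]0%R, +oo[) (g t)%:E)%E \is a fin_num.
  by rewrite ge0_fin_numE//; apply: integral_ge0 => t _; rewrite lee_fin.
by apply: lt_le_trans c0 _; rewrite -lee_fin fineK.
Qed.

End gamma.

(** * Vector fields *)

(** The two values of 2k + n - 1 are 2s and 2s - 1. The first lies in (0, 2) and is an integer only
    for s = 1/2; the second is below 1. The exponents k themselves are negative, except that for n =
    2 the first is s - 1/2, which lies in (-1/2, 1/2) and is 0 only for s = 1/2. *)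
Lemma exponents_neq (R : realType) (n : nat) (s : R) :
  (2 <= n)%N -> 0 < s -> s < 1 -> s != 2^-1 -> forall d : nat,
  [/\ s + 2^-1 - n%:R / 2 != d%:R, 2 * (s + 2^-1 - n%:R / 2) + n%:R - 1 != d.+1%:R,
      s - n%:R / 2 != d%:R & 2 * (s - n%:R / 2) + n%:R - 1 != d.+1%:R].
Proof.
move=> n2 s0 s1 sh d.
have {n2} [n3|n2] : 3 <= n%:R :> R \/ n%:R = 2 :> R.
  have [n3|] := leqP 3 n; [by left; rewrite ler_nat|rewrite ltnS => n2'].
  by right; congr (_%:R); apply/eqP; rewrite eqn_leq n2' n2.
all: have d0 := ler0n R d; rewrite -[d.+1%:R]natr1.
all: have [d1|->] : 1 <= d%:R :> R \/ d%:R = 0 :> R by [case: (d) => [|d']; [right|left; rewrite ler1n]].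
all: split; apply/eqP => e; first [lra | by move/eqP: sh; apply; lra].
Qed.

Section vector_fields.
Context {R : realType} {n : nat}.
Local Notation V := 'rV[R]_n.
Local Notation mu := (lebesgue_rV n : {measure set V -> \bar R}).
Local Notation ei i := (delta_mx ord0 i : V).

Lemma integrable_shift_admissible (v K : V -> R) (U : set V) x :
  measurable_fun setT (v : V -> measurableTypeR R) -> rapid v ->
  open U -> (forall y, U y -> v y = 0) -> U x -> admissible K ->
  mu.-integrable setT (EFin \o (fun y => v (x + y) * K y)).
Proof.
move=> mv rv oU vU Ux [mK tK]; have [r r0 /(_ v vU) fr] := flat_shift oU Ux.
by apply: (integrable_rapidM (r := r)) => //; [exact: measurable_shift|exact: rapid_shift|exact: tK].
Qed.

Lemma Rintegral_sum (I : eqType) (s : seq I) (F : I -> V -> R) :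
  (forall i, i \in s -> mu.-integrable setT (EFin \o F i)) ->
  Rintegral mu setT (fun y => \sum_(i <- s) F i y) = \sum_(i <- s) Rintegral mu setT (F i) /\
  mu.-integrable setT (EFin \o (fun y => \sum_(i <- s) F i y)).
Proof.
elim: s => [|i s IH] iF.
  rewrite big_nil; under eq_Rintegral do rewrite big_nil.
  under [X in _.-integrable _ (EFin \o X)]eq_fun do rewrite big_nil.
  by split; [rewrite /Rintegral integral0|exact: integrable0].
have [E iS] := IH (fun j js => iF j (mem_behead (s := i :: s) js)).
have ii := iF i (mem_head i s).
rewrite big_cons -E; under eq_Rintegral do rewrite big_cons.
under [X in _.-integrable _ (EFin \o X)]eq_fun do rewrite big_cons.
by split; [exact: RintegralD|exact: (integrableD measurableT ii iS)].
Qed.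

Lemma rapid_sum (I : Type) (s : seq I) (F : I -> V -> R) :
  (forall i, rapid (F i)) -> rapid (fun y => \sum_(i <- s) F i y).
Proof.
move=> rF N; elim: s => [|i s [C hC]].
  by exists 0 => y; rewrite big_nil normr0 mul0r.
have [D hD] := rF i N; exists (D + C) => y; rewrite big_cons.
apply: le_trans (lerD (hD y) (hC y)); rewrite -mulrDl ler_wpM2r ?ler_normD//.
by rewrite exprn_ge0// ltW// J_gt0.
Qed.

Lemma pder_sum (I : Type) (s : seq I) i (F F' : I -> V -> R) :
  (forall j, pder i (F j) (F' j)) ->
  pder i (fun y => \sum_(j <- s) F j y) (fun y => \sum_(j <- s) F' j y).
Proof.
move=> pF; elim: s => [|j s IH] y.
  under eq_fun do rewrite big_nil.
  by rewrite big_nil; exact: (is_derive_cst (0 : R) (0 : R) (1 : R)).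
under eq_fun do rewrite big_cons; rewrite big_cons.
exact: (is_deriveD (pF j y) (IH y)).
Qed.

Variables (s : R) (D : 'I_n -> seq 'I_n -> V -> R) (U E : set V).
Hypotheses (n_ge2 : (2 <= n)%N) (s_gt0 : 0 < s) (s_lt1 : s < 1) (s_neq : s != 2^-1)
  (cD : forall j b, continuous (D j b)) (pD : forall j i b, pder i (D j b) (D j (i :: b)))
  (rD : forall j b, rapid (D j b)) (oU : open U)
  (DU : forall j x, U x -> D j [::] x = 0) (EU : E `<=` U) (E0 : (0 < lebesgue_outer E)%E).

(* A^0 is the convolution of div f with N2^k0, and, when div f = 0, A^1 is that of f with N2^k1, up to nonzero constants. *)
Let k0 : R := s + 2^-1 - n%:R / 2.
Let k1 : R := s - n%:R / 2.

Hypotheses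
  (A0E : forall x, E x ->
    Rintegral mu setT (fun y => \sum_j D j [::] (x + y) * (N2 y `^ k0 * inv_coord j y)) = 0)
  (A1E : forall x, E x -> forall i,
    Rintegral mu setT (fun y => \sum_j D j [::] (x + y) * (y ord0 i * (N2 y `^ k1 * inv_coord j y))) = 0).

Let mD j b : measurable_fun setT (D j b : V -> measurableTypeR R).
Proof. exact: continuous_measurable_rV. Qed.

Let DbU j b x : U x -> D j b x = 0.
Proof. exact: (vanishing_pders oU (pD j) (@DU j)). Qed.

Let ibp x j (K K' : V -> R) : U x -> admissible K -> admissible K' ->
  (forall y, 0 < N2 y -> is_derive (0 : R) (1 : R) (fun t : R => K (y + t *: ei j)) (K' y)) ->
  Rintegral mu setT (fun y => D j [:: j] (x + y) * K y) =
  - Rintegral mu setT (fun y => D j [::] (x + y) * K' y).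
Proof.
move=> Ux [mK tK] [mK' tK'] dK.
have [r r0 fr] := flat_shift oU Ux.
apply: (integration_by_parts_pder r0 _ _ mK mK' (pder_shift x (pD j j [::]))) => //.
- exact: measurable_shift.
- exact: measurable_shift.
- exact: rapid_shift.
- exact: rapid_shift.
- exact/fr/DbU.
- exact/fr/DbU.
- exact: tK.
- exact: tK'.
Qed.

Let Rsum (F : 'I_n -> V -> R) : (forall i, mu.-integrable setT (EFin \o F i)) ->
  Rintegral mu setT (fun y => \sum_i F i y) = \sum_i Rintegral mu setT (F i).
Proof. by move=> iF; have [] := @Rintegral_sum _ (index_enum 'I_n) F (fun i _ => iF i). Qed.

Let int_shift j b x K : U x -> admissible K ->
  mu.-integrable setT (EFin \o (fun y => D j b (x + y) * K y)).
Proof. by move=> Ux aK; apply: integrable_shift_admissible oU (@DbU j b) Ux aK. Qed.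

Lemma divergence_eq0 x : \sum_j D j [:: j] x = 0.
Proof.
(* The direction j of the divergence stands last and is applied innermost, so putting i in front
   differentiates the whole sum. *)
pose H b y := \sum_j D j (rcons b j) y.
apply: (@unique_continuation R n H k0 U E).
- move=> b; apply: continuous_big => [|j _]; [exact: add_continuous|exact: cD].
- by move=> i b; apply: pder_sum => j; exact: pD.
- by move=> b; apply: rapid_sum => j; exact: rD.
- by move=> d; have [] := exponents_neq n_ge2 s_gt0 s_lt1 s_neq d.
- by move=> d; have [] := exponents_neq n_ge2 s_gt0 s_lt1 s_neq d.
- exact: oU.
- by move=> y Uy; rewrite /H big1// => j _; exact: DbU.
- exact: EU.
- exact: E0.
move=> y Ey; have Uy := EU Ey.
under eq_Rintegral do rewrite /H mulr_suml.
rewrite Rsum; last by move=> j; apply: int_shift => //; exact: admissible_powN2.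
have aj j : admissible (fun z : V => N2 z `^ k0 * inv_coord j z).
  exact: admissibleM (admissible_powN2 k0) (admissible_inv_coord j).
(* The j-th derivative of |y|^(2 k0) is 2 k0 |y|^(2 k0) w_j, which is the kernel of A^0 up to the
   factor. *)
transitivity (\sum_j - (2 * k0) * Rintegral mu setT (fun z => D j [::] (y + z) * (N2 z `^ k0 * inv_coord j z))).
  apply: eq_bigr => j _.
  rewrite [LHS](@ibp y j (fun z => N2 z `^ k0) _ Uy (admissible_powN2 k0)
    (admissibleM (admissible_cst (2 * k0)) (aj j)) (fun z z0 => is_derive_powN2 k0 j z0)).
  under eq_Rintegral do rewrite mulrCA.
  by rewrite RintegralZl ?mulNr//; exact: int_shift.
rewrite -mulr_sumr -Rsum ?A0E ?mulr0//.
by move=> j; exact: int_shift.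
Qed.

(** The vanishing divergence is integrated against y_i |y|^(2 k1). By parts, the j-th derivative of
    this kernel is delta_ij |y|^(2 k1) plus 2 k1 times the kernel of A^1; the latter contributes 0
    on E, and what remains is the potential of the component f_i alone. *)
Lemma vector_field_eq0 i x : D i [::] x = 0.
Proof.
apply: (@unique_continuation R n (D i) k1 U E) => //.
- by move=> d; have [] := exponents_neq n_ge2 s_gt0 s_lt1 s_neq d.
- by move=> d; have [] := exponents_neq n_ge2 s_gt0 s_lt1 s_neq d.
- by move=> z; exact: DU.
move=> y Ey; have Uy := EU Ey.
have aj j : admissible (fun z : V => z ord0 i * (N2 z `^ k1 * inv_coord j z)).
  apply: admissibleM; first exact: admissible_coord.
  exact: admissibleM (admissible_powN2 k1) (admissible_inv_coord j).
have aK : admissible (fun z : V => z ord0 i * N2 z `^ k1).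
  exact: admissibleM (admissible_coord i) (admissible_powN2 k1).
have aD j : admissible (fun z : V => (j == i)%:R * N2 z `^ k1).
  exact: admissibleM (admissible_cst _) (admissible_powN2 k1).
have aC j : admissible (fun z : V => 2 * k1 * (z ord0 i * (N2 z `^ k1 * inv_coord j z))).
  exact: admissibleM (admissible_cst _) (aj j).
have : \sum_j Rintegral mu setT (fun z => D j [:: j] (y + z) * (z ord0 i * N2 z `^ k1)) = 0.
  rewrite -Rsum; last by move=> j; exact: int_shift.
  under eq_Rintegral do rewrite -mulr_suml divergence_eq0 mul0r.
  by rewrite /Rintegral integral0.
have E1 j : Rintegral mu setT (fun z => D j [:: j] (y + z) * (z ord0 i * N2 z `^ k1)) =
    - ((j == i)%:R * Rintegral mu setT (fun z => D j [::] (y + z) * N2 z `^ k1)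
     + 2 * k1 * Rintegral mu setT (fun z => D j [::] (y + z) * (z ord0 i * (N2 z `^ k1 * inv_coord j z)))).
  have dK (z : V) : 0 < N2 z -> is_derive (0 : R) (1 : R)
      (fun t : R => (z + t *: ei j) ord0 i * N2 (z + t *: ei j) `^ k1)
      ((j == i)%:R * N2 z `^ k1 + 2 * k1 * (z ord0 i * (N2 z `^ k1 * inv_coord j z))).
    move=> z0; have e0 : z + 0 *: ei j = z by rewrite scale0r addr0.
    have H := is_deriveM (is_derive_coord z j i) (is_derive_powN2 k1 j z0).
    by apply: (is_derive_eq H); rewrite e0 /GRing.scale/=; ring.
  rewrite [LHS](@ibp y j (fun z => z ord0 i * N2 z `^ k1) _ Uy aK (admissibleD (aD j) (aC j)) dK).
  congr (- _); under eq_Rintegral do rewrite mulrDr.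
  rewrite RintegralD//; [|exact: int_shift|exact: int_shift].
  congr (_ + _); under eq_Rintegral do rewrite mulrCA.
    by rewrite RintegralZl//; apply: int_shift => //; exact: admissible_powN2.
  by rewrite RintegralZl//; exact: int_shift.
rewrite (eq_bigr _ (fun j _ => E1 j)) sumrN big_split/= -mulr_sumr -Rsum; last first.
  by move=> j; exact: int_shift.
rewrite A1E// mulr0 addr0 (bigD1 i)//= eqxx mul1r big1 ?addr0; last first.
  by move=> j /negbTE ->; rewrite mul0r.
by move/eqP; rewrite oppr_eq0 => /eqP.
Qed.

End vector_fields.

(** * Beam averages of real fields as convolutions *)

Section real_beam.
Context {R : realType} {n : nat}.
Local Notation V := 'rV[R]_n.
Local Notation leb := (@lebesgue_measure R).
Local Notation mu := (lebesgue_rV n : {measure set V -> \bar R}).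

Definition real_beam (s : R) (v : 'I_n -> V -> R) (x xi : V) : R :=
  Rintegral leb `]0, +oo[ (fun t => t `^ (2 * s - 1) * \sum_j v j (x + t *: xi) * xi ord0 j).

(** The polar density t^(n-1) times the kernel on a ray. For k = s + 1/2 - n/2 the exponent is 2s -
    1, the weight of the beam transform. *)
Lemma powR_ray (xi : V) (t k : R) j : unit_sphere n xi -> 0 < t -> (0 < n)%N ->
  t ^+ n.-1 * (N2 (t *: xi) `^ k * inv_coord j (t *: xi)) =
  t `^ (2 * k + n%:R - 2) * xi ord0 j.
Proof.
move=> xi1 t0 n0; rewrite /inv_coord N2_ray// mxE.
have t2 : t `^ 2 = t ^+ 2 by rewrite powR_mulrn// ltW.
rewrite -{1}t2 -powRrM -[t ^+ n.-1]powR_mulrn ?ltW//.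
have -> : 2 * k + n%:R - 2 = n.-1%:R + 2 * k + (- 1).
  by rewrite -[in n%:R](prednK n0) -natr1; ring.
have tn : t != 0 by rewrite gt_eqF.
rewrite !powRD ?tn ?implybT// powR_inv1 ?ltW//.
by set a := t `^ _; set b := t `^ _; field.
Qed.

Variables (s : R) (D : 'I_n -> seq 'I_n -> V -> R) (U E : set V).
Hypotheses (n_ge2 : (2 <= n)%N) (s_gt0 : 0 < s) (s_lt1 : s < 1) (s_neq : s != 2^-1)
  (cD : forall j b, continuous (D j b)) (pD : forall j i b, pder i (D j b) (D j (i :: b)))
  (rD : forall j b, rapid (D j b)) (oU : open U)
  (DU : forall j x, U x -> D j [::] x = 0) (EU : E `<=` U) (E0 : (0 < lebesgue_outer E)%E).
Hypotheses
  (B0 : forall x, E x -> Rintegral (surface_measure n) (unit_sphere n)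
     (real_beam s (fun j => D j [::]) x) = 0)
  (B1 : forall x, E x -> forall i, Rintegral (surface_measure n) (unit_sphere n)
     (fun xi => xi ord0 i * real_beam s (fun j => D j [::]) x xi) = 0).

Let n_gt0 : (0 < n)%N. Proof. exact: ltn_trans n_ge2. Qed.

Lemma measurable_field_sum x (K : 'I_n -> V -> R) : (forall j, admissible (K j)) ->
  measurable_fun setT ((fun y => \sum_j D j [::] (x + y) * K j y) : V -> measurableTypeR R).
Proof.
move=> aK; apply: measurable_sum => j; apply: measurable_funM; last by have [] := aK j.
by apply: measurable_shift; exact: continuous_measurable_rV.
Qed.

Lemma decay_field_sum x (K : 'I_n -> V -> R) : U x -> (forall j, admissible (K j)) ->
  exists C, forall y, `|\sum_j D j [::] (x + y) * K j y| * J y ^+ n.+1 <= C.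
Proof.
move=> Ux aK; apply: (@rapid_sum R n _ (index_enum 'I_n) (fun j y => D j [::] (x + y) * K j y)) => j.
have [r r0 /(_ _ (@DU j)) fr] := flat_shift oU Ux.
have [_ tK] := aK j.
exact: rapidM_tempered (rapid_shift x (rD j [::])) fr (tK r r0).
Qed.

Let k0 : R := s + 2^-1 - n%:R / 2.
Let k1 : R := s - n%:R / 2.

Let K0 j (y : V) := N2 y `^ k0 * inv_coord j y.
Let K1 i j (y : V) := y ord0 i * (N2 y `^ k1 * inv_coord j y).

Let aK0 j : admissible (K0 j).
Proof. exact: admissibleM (admissible_powN2 k0) (admissible_inv_coord j). Qed.

Let aK1 i j : admissible (K1 i j).
Proof.
apply: admissibleM; first exact: admissible_coord.
exact: admissibleM (admissible_powN2 k1) (admissible_inv_coord j).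
Qed.

Lemma real_beamE x xi : unit_sphere n xi -> real_beam s (fun j => D j [::]) x xi =
  Rintegral leb `]0, +oo[ (fun t => t ^+ n.-1 * \sum_j D j [::] (x + t *: xi) * K0 j (t *: xi)).
Proof.
move=> xi1; apply: eq_Rintegral => t; rewrite inE/= in_itv/= andbT => t0.
rewrite !mulr_sumr; apply: eq_bigr => j _.
rewrite [RHS]mulrCA powR_ray//.
have -> : 2 * k0 + n%:R - 2 = 2 * s - 1 by rewrite /k0; field.
by rewrite mulrCA.
Qed.

Lemma field_eq0 i x : D i [::] x = 0.
Proof.
apply: (@vector_field_eq0 R n s D U E) => // {}x Ex; have Ux := EU Ex.
  rewrite -[RHS](B0 Ex) -[LHS]Rintegral_polar//.
  - by apply: eq_Rintegral => xi; rewrite inE => xi1; rewrite [RHS]real_beamE.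
  - exact: measurable_field_sum.
  - exact: decay_field_sum.
move=> {}i; rewrite -[RHS](B1 Ex i) -[LHS]Rintegral_polar//; last 2 first.
- exact: (measurable_field_sum x (aK1 i)).
- exact: (decay_field_sum Ux (aK1 i)).
apply: eq_Rintegral => xi; rewrite inE => xi1; rewrite [in RHS]real_beamE// -[RHS]RintegralZl//; last first.
  exact: (@integrable_ray R n (fun y => \sum_j D j [::] (x + y) * K0 j y) xi
    (measurable_field_sum x aK0) (decay_field_sum Ux aK0) xi1).
apply: eq_Rintegral => t; rewrite inE/= in_itv/= andbT => t0.
rewrite !mulr_sumr; apply: eq_bigr => j _.
have -> : t ^+ n.-1 * (D j [::] (x + t *: xi) * K1 i j (t *: xi)) = D j [::] (x + t *: xi) *
    ((t *: xi) ord0 i * (t ^+ n.-1 * (N2 (t *: xi) `^ k1 * inv_coord j (t *: xi)))).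
  by rewrite /K1; ring.
have -> : xi ord0 i * (t ^+ n.-1 * (D j [::] (x + t *: xi) * K0 j (t *: xi))) = D j [::] (x + t *: xi) *
    (xi ord0 i * (t ^+ n.-1 * (N2 (t *: xi) `^ k0 * inv_coord j (t *: xi)))).
  by rewrite /K0; ring.
rewrite !powR_ray// mxE.
have tn : t != 0 by rewrite gt_eqF.
(* The kernel of A^1 carries the extra factor y_i = t xi_i, and this power of t makes up for k1 = k0
   - 1/2. *)
have -> : 2 * k0 + n%:R - 2 = (2 * k1 + n%:R - 2) + 1 by rewrite /k0 /k1; field.
set e := 2 * k1 + n%:R - 2; have -> : t `^ (e + 1) = t `^ e * t.
  by rewrite powRD ?tn ?implybT// powRr1// ltW.
by ring.
Qed.

End real_beam.

(** * Complex-valued fields *)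

Section schwartz_parts.
Context {R : realType} {n : nat}.
Local Notation V := 'rV[R]_n.
Local Open Scope complex_scope.

(** The monomial bounds of [schwartz] for one derivative; multiplying repeatedly by the polynomial J
    turns them into [rapid]. *)
Definition poly_bounded (v : V -> R) := forall a : 'I_n -> nat, exists M, forall x : V,
  `|\prod_i x ord0 i ^+ a i * v x| <= M.

Lemma poly_boundedD v w : poly_bounded v -> poly_bounded w -> poly_bounded (fun x => v x + w x).
Proof.
move=> pv pw a; have [M hM] := pv a; have [N hN] := pw a; exists (M + N) => x.
by rewrite mulrDr (le_trans (ler_normD _ _))// lerD.
Qed.

Lemma poly_bounded_coord i v : poly_bounded v -> poly_bounded (fun x => x ord0 i * v x).
Proof.
move=> pv a; have [M hM] := pv (fun j => (a j + (j == i))%N); exists M => x.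
apply: le_trans (hM x); rewrite le_eqVlt; apply/orP; left; apply/eqP; congr `|_|.
under [in RHS]eq_bigr do rewrite exprD.
rewrite big_split/= mulrA; congr (_ * _ * _).
rewrite (bigD1 i)//= eqxx expr1 big1 ?mulr1// => j /negbTE ->.
by rewrite expr0.
Qed.

Lemma poly_boundedJ v : poly_bounded v -> poly_bounded (fun x => J x * v x).
Proof.
move=> pv; have E (x : V) : J x * v x = v x + \sum_i x ord0 i * (x ord0 i * v x).
  by rewrite /J mulrDl mul1r mulr_suml; congr (_ + _); apply: eq_bigr => i _; rewrite mulrA expr2.
under eq_fun do rewrite E.
apply: poly_boundedD => //; elim: (index_enum 'I_n) => [|i l IH].
  by under eq_fun do rewrite big_nil; move=> a; exists 0 => x; rewrite mulr0 normr0.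
under eq_fun do rewrite big_cons.
by apply: poly_boundedD => //; do 2 apply: poly_bounded_coord.
Qed.

Lemma poly_bounded_rapid v : poly_bounded v -> rapid v.
Proof.
move=> pv N; have : poly_bounded (fun x => J x ^+ N * v x).
  elim: N => [|N IH]; first by under eq_fun do rewrite expr0 mul1r.
  by under eq_fun do rewrite exprS -mulrA; exact: poly_boundedJ.
move=> /(_ (fun=> 0%N))[M hM]; exists M => x; apply: le_trans (hM x).
rewrite big1 ?mul1r// normrM mulrC ler_wpM2r//.
exact: ler_norm.
Qed.

Lemma normc_ge_part (z : R[i]) (M : R) : `|z| <= M%:C ->
  `|complex.Re z| <= M /\ `|complex.Im z| <= M.
Proof.
rewrite normc_def lecR => h.
split; apply: le_trans h; rewrite -sqrtr_sqr ler_wsqrtr//.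
  by rewrite lerDl sqr_ge0.
by rewrite lerDr sqr_ge0.
Qed.

Lemma ReCM (a : R) (z : R[i]) : complex.Re (a%:C * z) = a * complex.Re z.
Proof. by case: z => u v /=; rewrite mul0r subr0. Qed.

Lemma ImCM (a : R) (z : R[i]) : complex.Im (a%:C * z) = a * complex.Im z.
Proof. by case: z => u v /=; rewrite mul0r addr0. Qed.

Lemma ReD (y z : R[i]) : complex.Re (y + z) = complex.Re y + complex.Re z.
Proof. by case: y z => ? ? []. Qed.

Lemma ImD (y z : R[i]) : complex.Im (y + z) = complex.Im y + complex.Im z.
Proof. by case: y z => ? ? []. Qed.

Lemma schwartz_Re (g : V -> R[i]) : schwartz g -> let D b x := complex.Re (partials b g x) in
  [/\ forall b, continuous (D b), forall i b, pder i (D b) (D (i :: b)) & forall b, rapid (D b)].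
Proof.
move=> [sg bg] D; split=> [b|i b|b].
- by have [[]] := sg b.
- by apply: derivable_pder => x; have [_ /(_ i x)[]] := sg b.
- apply: poly_bounded_rapid => a; have [M hM] := bg a b; exists M => x.
  by have [+ _] := normc_ge_part (hM x); rewrite ReCM.
Qed.

Lemma schwartz_Im (g : V -> R[i]) : schwartz g -> let D b x := complex.Im (partials b g x) in
  [/\ forall b, continuous (D b), forall i b, pder i (D b) (D (i :: b)) & forall b, rapid (D b)].
Proof.
move=> [sg bg] D; split=> [b|i b|b].
- by have [[]] := sg b.
- by apply: derivable_pder => x; have [_ /(_ i x)[]] := sg b.
- apply: poly_bounded_rapid => a; have [M hM] := bg a b; exists M => x.
  by have [_] := normc_ge_part (hM x); rewrite ImCM.
Qed.

Lemma Re_beam s (f : 'I_n -> V -> R[i]) x xi :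
  complex.Re (beam s f x xi) = real_beam s (fun j y => complex.Re (f j y)) x xi.
Proof.
apply: eq_Rintegral => t _; rewrite ReCM; congr (_ * _).
rewrite (big_morph (@complex.Re R) ReD (erefl : complex.Re (0 : R[i]) = 0)).
by apply: eq_bigr => j _; rewrite mulrC ReCM mulrC.
Qed.

Lemma Im_beam s (f : 'I_n -> V -> R[i]) x xi :
  complex.Im (beam s f x xi) = real_beam s (fun j y => complex.Im (f j y)) x xi.
Proof.
apply: eq_Rintegral => t _; rewrite ImCM; congr (_ * _).
rewrite (big_morph (@complex.Im R) ImD (erefl : complex.Im (0 : R[i]) = 0)).
by apply: eq_bigr => j _; rewrite mulrC ImCM mulrC.
Qed.

Lemma neg_quotient_neq0 (a b c d : R) :
  0 < a -> 0 < b -> 0 < c -> 0 < d -> - a / (b * c * d) != 0.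
Proof.
move=> a0 b0 c0 d0; apply: mulf_neq0; first by rewrite oppr_eq0 gt_eqF.
by rewrite invr_eq0 gt_eqF// !mulr_gt0.
Qed.

(** For s in (0, 1) and n >= 2 the Gamma arguments (n + 1 - 2s)/2 and s + 1/2 are positive, so [c10]
    is nonzero and cancels. *)
Lemma A0_eq0 s (f : 'I_n -> V -> R[i]) x : 0 < s -> s < 1 -> (2 <= n)%N -> A0 s f x = 0 ->
  Rintegral (surface_measure n) (unit_sphere n) (real_beam s (fun j y => complex.Re (f j y)) x) = 0 /\
  Rintegral (surface_measure n) (unit_sphere n) (real_beam s (fun j y => complex.Im (f j y)) x) = 0.
Proof.
move=> s0 s1 n2 /eqP; rewrite mulf_eq0 => /orP[/eqP[c0]|].
  have n2' : 2 <= n%:R :> R by rewrite ler_nat.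
  have : c10 n s != 0.
    by apply: neg_quotient_neq0; rewrite ?powR_gt0 ?pi_gt0//; apply: Gamma_gt0; lra.
  by rewrite c0 eqxx.
rewrite /complex_integral eq_complex => /andP[/eqP h1 /eqP h2].
split; [apply: etrans h1|apply: etrans h2]; apply: eq_Rintegral => xi _.
  by rewrite Re_beam.
by rewrite Im_beam.
Qed.

Lemma A1_eq0 s (f : 'I_n -> V -> R[i]) i x : 0 < s -> s < 1 -> (2 <= n)%N -> A1 s f i x = 0 ->
  Rintegral (surface_measure n) (unit_sphere n)
    (fun xi => xi ord0 i * real_beam s (fun j y => complex.Re (f j y)) x xi) = 0 /\
  Rintegral (surface_measure n) (unit_sphere n)
    (fun xi => xi ord0 i * real_beam s (fun j y => complex.Im (f j y)) x xi) = 0.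
Proof.
move=> s0 s1 n2 /eqP; rewrite mulf_eq0 => /orP[/eqP[c0]|].
  have n2' : 2 <= n%:R :> R by rewrite ler_nat.
  have : c11 n s != 0.
    by apply: neg_quotient_neq0; rewrite ?powR_gt0 ?pi_gt0//; apply: Gamma_gt0; lra.
  by rewrite c0 eqxx.
rewrite /complex_integral eq_complex => /andP[/eqP h1 /eqP h2].
split; [apply: etrans h1|apply: etrans h2]; apply: eq_Rintegral => xi _.
  by rewrite ReCM Re_beam.
by rewrite ImCM Im_beam.
Qed.

End schwartz_parts.

Unset Implicit Arguments.
Set Strict Implicit.
Set Printing Implicit Defensive.

Theorem theorem4p11 (R : realType) (n : nat) (n_ge2 : (2 <= n)%N)
    (s : R) (s_gt0 : 0 < s) (s_lt1 : s < 1) (s_neq : s != 2^-1)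
    (f : 'I_n -> 'rV[R]_n -> R[i]) (f_schwartz : forall j, schwartz (f j))
    (U : set 'rV[R]_n) (U_open : open U) (U_neq0 : U !=set0)
    (f_U : forall x, U x -> forall j, f j x = 0)
    (A_E : exists E : set 'rV[R]_n,
      [/\ lebesgue_measurable E, E `<=` U, (0 < lebesgue_outer E)%E &
          forall x, E x -> A0 s f x = 0 /\ forall i, A1 s f i x = 0]) :
  forall j x, f j x = 0.
Proof.
have [E [_ EU E0 AE]] := A_E => i x.
(* The kernels are real, so the real and the imaginary part of the field satisfy the hypotheses
   separately. *)
have hRe : complex.Re (f i x) = 0.
  apply: (@field_eq0 R n s (fun j b y => complex.Re (partials b (f j) y)) U E) => //.
  - by move=> j b; have [] := schwartz_Re (f_schwartz j).
  - by move=> j k b; have [] := schwartz_Re (f_schwartz j).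
  - by move=> j b; have [] := schwartz_Re (f_schwartz j).
  - by move=> j y Uy; rewrite /= f_U.
  - by move=> y Ey; have [+ _] := AE y Ey; move=> /(A0_eq0 s_gt0 s_lt1 n_ge2)[].
  - by move=> y Ey k; have [_ +] := AE y Ey; move=> /(_ k)/(A1_eq0 s_gt0 s_lt1 n_ge2)[].
have hIm : complex.Im (f i x) = 0.
  apply: (@field_eq0 R n s (fun j b y => complex.Im (partials b (f j) y)) U E) => //.
  - by move=> j b; have [] := schwartz_Im (f_schwartz j).
  - by move=> j k b; have [] := schwartz_Im (f_schwartz j).
  - by move=> j b; have [] := schwartz_Im (f_schwartz j).
  - by move=> j y Uy; rewrite /= f_U.
  - by move=> y Ey; have [+ _] := AE y Ey; move=> /(A0_eq0 s_gt0 s_lt1 n_ge2)[].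
  - by move=> y Ey k; have [_ +] := AE y Ey; move=> /(_ k)/(A1_eq0 s_gt0 s_lt1 n_ge2)[].
by apply/eqP; rewrite eq_complex hRe hIm/= !eqxx.
Qed.
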